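(* Let $D$ be a weighted oriented graph whose underlying graph $G$ is a complete graph, and let $K$ be a field. The following conditions are equivalent: 1) $I(D)$ is unmixed. 2) $I(D)$ is Cohen-Macaulay. 3) There are no unicycle oriented subgraphs $D_1,\dots,D_s$ ($s\geq 1$) of $D$ such that $V(D_1),\dots,V(D_s)$ is a partition of $V(D)$.
   Context: A weighted oriented graph is a triplet $D=(V(D),E(D),w)$ where $V=V(D)$ is a finite set, $E=E(D)\subseteq V\times V$ is the edge set of an oriented graph (no loops, and for $x\neq y$ at most one of $(x,y),(y,x)$ is in $E$), and $w:V\to\mathbb{N}=\{1,2,\dots\}$ is the weight function. Its underlying graph $G$ is the simple graph on $V$ with edge set $\{\{x,y\}:(x,y)\in E\}$. A source is a vertex with no in-neighbours. Standing assumption: if $x$ is a source of $D$, then $w(x)=1$. Subgraphs (not necessarily induced) of $D$ carry the restricted weights; the standing assumption is not imposed on subgraphs. Writing $V=\{x_1,\dots,x_n\}$, vertices are identified with the variables of $R=K[x_1,\dots,x_n]$. The edge ideal is $I(D)=(x_ix_j^{w(x_j)} : (x_i,x_j)\in E)\subseteq R$. $I(D)$ is called Cohen-Macaulay if $R/I(D)$ is a Cohen-Macaulay ring. An ideal is unmixed if all its associated primes have the same height. An oriented cycle is a weighted oriented graph whose underlying graph is a cycle, with vertices $x_1,\dots,x_m$ ($m\ge 3$) and edges $(x_1,x_2),\dots,(x_{m-1},x_m),(x_m,x_1)$. A weighted oriented graph $U$ is a unicycle oriented graph if: (i) the underlying graph of $U$ is connected and has exactly one cycle $C$; (ii) $C$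 is an oriented cycle in $U$, and for each $y\in V(U)\setminus V(C)$ there is an oriented (directed) path in $U$ from a vertex of $C$ to $y$; (iii) $w(x)\neq 1$ for every $x\in V(U)$ whose degree in the underlying graph of $U$ is at least $2$. A unicycle oriented subgraph of $D$ is a subgraph of $D$ that is a unicycle oriented graph. *)

(* Defs.v *)
From HB Require Import structures.
From mathcomp Require Import all_boot all_order all_algebra.
From mathcomp Require Import generic_quotient ring_quotient.
From mathcomp Require Import ring boolp.
From mathcomp.multinomials Require Import mpoly.

Set Implicit Arguments.
Unset Strict Implicit.
Unset Printing Implicit Defensive.

Import GRing.Theory.
Local Open Scope ring_scope.
Local Open Scope quotient_scope.

(* In ring_quotient, [idealr A] is the type of proper ideals of A and
   [prime_idealr A] the type of its prime ideals.  Their membership predicates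
   are boolean; with [asbool] every subset of A is such a predicate. *)

Section Ideals.
Variable A : comNzRingType.
Implicit Types (s : seq A) (d : nat).

Definition ideal_gen s : {pred A} := fun f =>
  `[< exists c : 'I_(size s) -> A, f = \sum_i c i * s`_i >].

Lemma ideal_gen0 s : 0 \in ideal_gen s.
Proof.
by apply/asboolP; exists (fun=> 0); rewrite big1 // => i _; rewrite mul0r.
Qed.

Lemma ideal_gen_linear s a :
  {in ideal_gen s &, forall u v, a * u + v \in ideal_gen s}.
Proof.
move=> u v /asboolP[c ->] /asboolP[d ->]; apply/asboolP.
exists (fun i => a * c i + d i); rewrite mulr_sumr -big_split /=.
by apply: eq_bigr => i _; rewrite mulrDl mulrA.
Qed.

Definition maximal_ideal (m : idealr A) :=
  forall J : idealr A, {subset m <= J} -> {subset J <= m}.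

Definition noetherian :=
  forall I : idealr A, exists s, I =i ideal_gen s.

Definition prime_chain d (c : nat -> prime_idealr A) :=
  forall i, (i < d)%N ->
    {subset c i <= c i.+1} /\ ~ {subset c i.+1 <= c i}.

Definition has_height (P : prime_idealr A) d :=
  (exists2 c, prime_chain d c & c d =i P) /\
  (forall k c, prime_chain k c -> c k =i P -> (k <= d)%N).

Definition has_krull_dim d :=
  (exists c, prime_chain d c) /\
  (forall k c, prime_chain k c -> (k <= d)%N).

(* P is the annihilator of the class of f in A/I *)
Definition associated_prime (I : {pred A}) (P : prime_idealr A) :=
  exists f : A, forall g, (g \in P) = (g * f \in I).

Definition unmixed (I : {pred A}) :=
  exists h, forall P : prime_idealr A, associated_prime I P -> has_height P h.

Definition regular_sequence s :=
  1 \notin ideal_gen s /\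
  forall i, (i < size s)%N ->
    forall b, s`_i * b \in ideal_gen (take i s) -> b \in ideal_gen (take i s).

Definition has_grade (J : {pred A}) d :=
  (exists s, [/\ regular_sequence s, {subset s <= J} & size s = d]) /\
  (forall s, regular_sequence s -> {subset s <= J} -> (size s <= d)%N).

(* The depth of a local ring is the grade of its maximal ideal. *)
Definition cohen_macaulay_local :=
  exists m : idealr A,
    [/\ maximal_ideal m, forall m' : idealr A, maximal_ideal m' -> m' =i m &
        exists2 d, has_grade m d & has_krull_dim d].

End Ideals.

Module Localization.
Section Localization.
Variables (A : comNzRingType) (P : prime_idealr A).

Record dom := Dom { frac :> A * A; _ : frac.2 \notin P }.

HB.instance Definition _ := [isSub for frac].
HB.instance Definition _ := [Choice of dom by <:].

Implicit Types x y z : dom.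

Lemma domP x : x.2 \notin P. Proof. by case: x. Qed.

Lemma notin1 : 1 \notin P. Proof. by rewrite idealr1. Qed.

Lemma notinM s t : s \notin P -> t \notin P -> s * t \notin P.
Proof. by move=> sP tP; rewrite prime_idealrM negb_or sP. Qed.

(* a/s = b/t iff u (a t - b s) = 0 for some u outside P *)
Definition equivl x y :=
  `[< exists2 u, u \notin P & u * (x.1 * y.2) = u * (y.1 * x.2) >].

Lemma equivl_refl : reflexive equivl.
Proof. by move=> x; apply/asboolP; exists 1; rewrite ?notin1. Qed.

Lemma equivl_sym : ssrbool.symmetric equivl.
Proof.
by move=> x y; apply/asboolP/asboolP => -[u uP e]; exists u => //; rewrite e.
Qed.

Lemma equivl_trans : transitive equivl.
Proof.
move=> y x z /asboolP[u uP e] /asboolP[v vP e']; apply/asboolP.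
exists (u * v * y.2); first by rewrite !notinM ?domP.
transitivity (v * z.2 * (u * (x.1 * y.2))); first by ring.
rewrite e; transitivity (u * x.2 * (v * (y.1 * z.2))); first by ring.
by rewrite e'; ring.
Qed.

Canonical equivl_equiv :=
  EquivRel equivl equivl_refl equivl_sym equivl_trans.

Definition type := {eq_quot equivl}.

HB.instance Definition _ : EqQuotient _ equivl type := EqQuotient.on type.
HB.instance Definition _ := Choice.on type.

Lemma equivlP x y :
  reflect (exists2 u, u \notin P & u * (x.1 * y.2) = u * (y.1 * x.2))
          (x == y %[mod type]).
Proof. by rewrite eqmodE; apply: asboolP. Qed.

Lemma repr_equivl x : exists2 u, u \notin P &
  u * ((repr (\pi_type x)).1 * x.2) = u * (x.1 * (repr (\pi_type x)).2).
Proof. by apply/equivlP; rewrite reprK. Qed.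

Definition ofring a : dom := @Dom (a, 1) notin1.

Definition addl x y : dom :=
  @Dom (x.1 * y.2 + y.1 * x.2, x.2 * y.2) (notinM (domP x) (domP y)).
Definition oppl x : dom := @Dom (- x.1, x.2) (domP x).
Definition mull x y : dom :=
  @Dom (x.1 * y.1, x.2 * y.2) (notinM (domP x) (domP y)).

Definition zero := \pi_type (ofring 0).
Definition one := \pi_type (ofring 1).
Definition add := lift_op2 type addl.
Definition opp := lift_op1 type oppl.
Definition mul := lift_op2 type mull.

Lemma pi_add : {morph \pi : x y / addl x y >-> add x y}.
Proof.
move=> x y; unlock add; apply/eqP/equivlP => /=.
have [u uP] := repr_equivl x; have [v vP] := repr_equivl y.
set y' := repr _ => ey; set x' := repr _ => ex; exists (u * v); rewrite ?notinM //.
transitivity (v * y.2 * y'.2 * (u * (x.1 * x'.2))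
            + u * x.2 * x'.2 * (v * (y.1 * y'.2))); first by ring.
by rewrite -ex -ey; ring.
Qed.
Canonical pi_add_morph := PiMorph2 pi_add.

Lemma pi_opp : {morph \pi : x / oppl x >-> opp x}.
Proof.
move=> x; unlock opp; apply/eqP/equivlP => /=.
have [u uP e] := repr_equivl x; exists u => //.
by rewrite !mulNr !mulrN e.
Qed.
Canonical pi_opp_morph := PiMorph1 pi_opp.

Lemma pi_mul : {morph \pi : x y / mull x y >-> mul x y}.
Proof.
move=> x y; unlock mul; apply/eqP/equivlP => /=.
have [u uP] := repr_equivl x; have [v vP] := repr_equivl y.
set y' := repr _ => ey; set x' := repr _ => ex; exists (u * v); rewrite ?notinM //.
transitivity (u * (x.1 * x'.2) * (v * (y.1 * y'.2))); first by ring.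
by rewrite -ex -ey; ring.
Qed.
Canonical pi_mul_morph := PiMorph2 pi_mul.

Lemma addA : associative add.
Proof.
elim/quotW=> x; elim/quotW=> y; elim/quotW=> z; rewrite !piE.
by apply/eqP/equivlP; exists 1; rewrite ?notin1 //=; ring.
Qed.

Lemma addC : commutative add.
Proof.
elim/quotW=> x; elim/quotW=> y; rewrite !piE.
by apply/eqP/equivlP; exists 1; rewrite ?notin1 //=; ring.
Qed.

Lemma add0l : left_id zero add.
Proof.
elim/quotW=> x; rewrite /zero !piE.
by apply/eqP/equivlP; exists 1; rewrite ?notin1 //=; ring.
Qed.

Lemma addNl : left_inverse zero opp add.
Proof.
elim/quotW=> x; rewrite /zero !piE.
by apply/eqP/equivlP; exists 1; rewrite ?notin1 //=; ring.
Qed.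

HB.instance Definition _ := GRing.isZmodule.Build type addA addC add0l addNl.

Lemma mulA : associative mul.
Proof.
elim/quotW=> x; elim/quotW=> y; elim/quotW=> z; rewrite !piE.
by apply/eqP/equivlP; exists 1; rewrite ?notin1 //=; ring.
Qed.

Lemma mulC : commutative mul.
Proof.
elim/quotW=> x; elim/quotW=> y; rewrite !piE.
by apply/eqP/equivlP; exists 1; rewrite ?notin1 //=; ring.
Qed.

Lemma mul1l : left_id one mul.
Proof.
elim/quotW=> x; rewrite /one !piE.
by apply/eqP/equivlP; exists 1; rewrite ?notin1 //=; ring.
Qed.

Lemma mulDl : left_distributive mul add.
Proof.
elim/quotW=> x; elim/quotW=> y; elim/quotW=> z; rewrite !piE.
by apply/eqP/equivlP; exists 1; rewrite ?notin1 //=; ring.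
Qed.

Lemma one_neq0 : one != zero.
Proof.
apply/negP => /equivlP[u uP] /=; rewrite !mulr1 mulr0 => u0.
by rewrite u0 idealr0 in uP.
Qed.

HB.instance Definition _ :=
  GRing.Zmodule_isComNzRing.Build type mulA mulC mul1l mulDl one_neq0.

End Localization.
End Localization.
HB.export Localization.

Definition localization (A : comNzRingType) (P : prime_idealr A)
  : comNzRingType := Localization.type P.

Definition cohen_macaulay (A : comNzRingType) :=
  noetherian A /\
  forall m : prime_idealr A, maximal_ideal m ->
    cohen_macaulay_local (localization m).

(* A graph is carried by a finite set of vertices inside an ambient finite
   type, so that a graph and its subgraphs have the same type. *)
Record wograph (T : finType) := WOGraph {
  vertices : {set T};
  edges : {set T * T};
  weight : T -> nat;
  _ : forall x y, (x, y) \in edges -> (x \in vertices) && (y \in vertices);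
  _ : forall x, (x, x) \notin edges;
  _ : forall x y, (x, y) \in edges -> (y, x) \notin edges;
  _ : forall x, x \in vertices -> (0 < weight x)%N }.

Section Graphs.
Variable T : finType.
Implicit Types (D H : wograph T) (x y : T) (c : seq T).

Definition dedge D : rel T := [rel x y | (x, y) \in edges D].

Definition adj D : rel T := [rel x y | dedge D x y || dedge D y x].

Definition is_source D x := x \in vertices D /\ forall y, ~~ dedge D y x.

Definition sources_have_weight1 D :=
  forall x, is_source D x -> weight D x = 1%N.

Definition degree D x := #|[set y | adj D x y]|.

Definition complete_underlying D :=
  {in vertices D &, forall x y, x != y -> adj D x y}.

Definition connected_underlying D :=
  vertices D != set0 /\ {in vertices D &, forall x y, connect (adj D) x y}.

Definition subgraph H D :=
  [/\ vertices H \subset vertices D, edges H \subset edges D &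
      {in vertices H, weight H =1 weight D}].

(* A cycle of the underlying graph, given by a cyclic listing of its vertices.
   Two listings describe the same cycle iff they have the same edges. *)
Definition underlying_cycle D c :=
  [&& (2 < size c)%N, uniq c & cycle (adj D) c].

Definition cycle_edges c : {set {set T}} := [set [set x; next c x] | x in c].

(* c lists the vertices of the unique cycle in the direction of its edges. *)
Definition unicycle_oriented D :=
  connected_underlying D /\
  exists c,
    [/\ underlying_cycle D c,
        forall c', underlying_cycle D c' -> cycle_edges c' = cycle_edges c,
        cycle (dedge D) c,
        forall y, y \in vertices D -> y \notin c ->
          exists2 x, x \in c & connect (dedge D) x y &
        forall x, x \in vertices D -> (2 <= degree D x)%N -> weight D x != 1%N].

Definition unicycle_partition D :=
  exists (s : nat) (F : 'I_s -> wograph T),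
    [/\ (1 <= s)%N,
        forall i, subgraph (F i) D /\ unicycle_oriented (F i),
        injective (fun i => vertices (F i)) &
        partition [set vertices (F i) | i : 'I_s] (vertices D)].

End Graphs.

Section EdgeIdeal.
Variables (K : fieldType) (n : nat) (D : wograph 'I_n).

Definition edge_generators : seq {mpoly K[n]} :=
  [seq 'X_e.1 * 'X_e.2 ^+ weight D e.2 | e <- enum (edges D)].

Definition edge_ideal : {pred {mpoly K[n]}} := ideal_gen edge_generators.

Lemma edge_ideal_idealr_closed : idealr_closed edge_ideal.
Proof.
split; [exact: ideal_gen0 | | exact: ideal_gen_linear].
apply/negP => /asboolP[c /(congr1 (meval (fun=> 0)))].
rewrite meval1 raddf_sum big1 => [/eqP|i _]; first by rewrite oner_eq0.
rewrite /= mevalM; set g := nth _ _ _.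
have /mapP[e _ ->] : g \in edge_generators by apply: mem_nth.
by rewrite mevalM mevalXU mul0r mulr0.
Qed.

HB.instance Definition _ :=
  isIdealr.Build {mpoly K[n]} edge_ideal edge_ideal_idealr_closed.

Definition edge_ring : comNzRingType := {ideal_quot edge_ideal}.

End EdgeIdeal.

Arguments edge_generators K {n} D.
Arguments edge_ideal K {n} D.
Arguments edge_ring K {n} D.

(* Main.v *)
Require Import Defs.
From HB Require Import structures.
From mathcomp Require Import all_boot all_order all_algebra.
From mathcomp Require Import generic_quotient ring_quotient.
From mathcomp Require Import ring zify boolp.
From mathcomp Require classical_sets.
From mathcomp.multinomials Require Import mpoly.

Set Implicit Arguments.
Unset Strict Implicit.
Unset Printing Implicit Defensive.

Import Order.TTheory GRing.Theory.
Local Open Scope ring_scope.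
Local Open Scope quotient_scope.

(* Both the unmixedness of [I(D)] and the existence of unicycle partitions reduce
   to one local condition: every vertex has an in-neighbour of weight different
   from 1.

   Choosing such an in-neighbour [p v] for every [v] gives a functional graph,
   whose components are unicycle oriented; conversely, in a unicycle oriented
   graph every vertex has an in-neighbour, which has degree at least 2.

   As [G] is complete, the minimal primes of [I(D)] are the ideals
   [P_i = (x_j : j != i)], of height [n - 1], and they are all associated.  A
   monomial outside [I(D)] lies in all the minimal primary components iff the
   local condition holds, in which case [(x_1, ..., x_n)] is the annihilator of
   [prod_i x_i ^ (w_i - 1)] modulo [I(D)]: there is an embedded prime and the
   depth at the origin is 0.  Otherwise [I(D)] is the intersection of its minimal
   primary components; every maximal ideal above it then contains an element
   outside all the [P_i], which is regular, while the dimension of the quotient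
   is 1.  The dimension theory rests on the bound [k <= n] for the length [k] of a
   chain of primes of [K[x_1, ..., x_n]]: choosing an element in each step of the
   chain gives [k] algebraically independent polynomials. *)

(** * Unicycle partitions *)

Section GraphCycles.
Variable T : finType.
Implicit Types (D H : wograph T) (x y z : T) (c : seq T).

Lemma edge_vertices D x y :
  dedge D x y -> (x \in vertices D) && (y \in vertices D).
Proof. by move: x y; rewrite /dedge /=; case: D. Qed.

Lemma dedgexx D x : dedge D x x = false.
Proof. by apply/negbTE; move: x; rewrite /dedge /=; case: D. Qed.

Lemma dedge_antisym D x y : dedge D x y -> dedge D y x = false.
Proof. by move=> xy; apply/negbTE; move: x y xy; rewrite /dedge /=; case: D. Qed.

Lemma weight_gt0 D x : x \in vertices D -> (0 < weight D x)%N.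
Proof. by move: x; case: D. Qed.

Definition all_dominated D :=
  [forall v, exists u, dedge D u v && (weight D u != 1%N)].

(** A vertex off the cycle is entered by the last edge of a directed path from the cycle. *)
Lemma unicycle_in_neighbour H v : unicycle_oriented H -> v \in vertices H ->
  exists u, dedge H u v.
Proof.
move=> [_ [c [_ _ cyc reach _]]] vH.
have [vc|vc] := boolP (v \in c); first by exists (prev c v); apply: prev_cycle.
have [x xc /connectP[q]] := reach v vH vc.
case/lastP: q => [|q y] /=; first by move=> _ e; rewrite e xc in vc.
by rewrite rcons_path last_rcons => /andP[_ ?] ->; exists (last x q).
Qed.

(** In the part of [v], take an in-neighbour [u] of [v] and an in-neighbour [r] of [u]. Antisymmetry
    gives [r != v], so [u] has degree at least 2 and its weight differs from 1. *)
Lemma unicycle_partition_dominated D : vertices D = [set: T] ->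
  unicycle_partition D -> (0 < #|T|)%N /\ all_dominated D.
Proof.
move=> V_full [s [F [s_gt0 FP _ /and3P[/eqP cov _ _]]]]; split.
  have [_ [[/set0Pn[x _] _] _]] := FP (Ordinal s_gt0).
  by apply/card_gt0P; exists x.
apply/forallP => v; have : v \in cover [set vertices (F i) | i : 'I_s].
  by rewrite cov V_full inE.
case/bigcupP => _ /imsetP[i _ ->] vF; have [[_ /subsetP sE wE] uni] := FP i.
have [u uv] := unicycle_in_neighbour uni vF.
have /andP[uF _] := edge_vertices uv; have [r ru] := unicycle_in_neighbour uni uF.
apply/existsP; exists u; rewrite [dedge _ _ _]sE //= -wE //.
have [_ [c [_ _ _ _ degw]]] := uni; apply: degw => //.
have rv : r != v by apply: contraTneq ru => ->; rewrite dedge_antisym.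
rewrite /degree (cardsD1 r) (cardsD1 v) !inE eq_sym rv.
by rewrite /adj /= ru uv orbT.
Qed.

Lemma cycle_edges_rev c : uniq c -> cycle_edges (rev c) = cycle_edges c.
Proof.
move=> Uc; apply/setP => e; apply/imsetP/imsetP => -[x xc ->].
  exists (prev c x); first by rewrite mem_prev -mem_rev.
  by rewrite next_rev // next_prev // setUC.
exists (next c x); first by rewrite mem_rev mem_next.
by rewrite next_rev // prev_next // setUC.
Qed.

(** * Components of a functional graph *)

Section FunctionalGraph.
Variable p : T -> T.

(* An edge [p (next x) -- next x] pointing backwards forces the following one to
   point backwards as well, since otherwise the cycle would have length two. *)
Lemma fcycle_of_underlying H c : {in c &, forall x y, adj H x y ->
      (p x == y) || (p y == x)} ->
    underlying_cycle H c -> fcycle p c \/ fcycle p (rev c).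
Proof.
move=> adjE /and3P[c3 Uc cyc]; pose N := next c.
have NN x : x \in c -> N (N x) != x.
  case/rot_to => i q rip; rewrite /N -!(next_rot i Uc) rip.
  move: c3; rewrite -(size_rot i) rip; have := rot_uniq i c; rewrite rip Uc.
  case: q {rip} => [|y [|z q]] //=; rewrite !inE !negb_or eqxx.
  case/and3P=> /and3P[xy xz _] _ _ _.
  by rewrite [y == x]eq_sym (negPf xy) eqxx eq_sym.
have step x : x \in c -> (p x == N x) || (p (N x) == x).
  by move=> xc; apply: adjE; rewrite ?mem_next //; apply: next_cycle cyc xc.
have [/existsP[x /andP[xc px]]|/existsPn none] :=
    boolP [exists x, (x \in c) && (p (N x) == x)]; [right|left]; last first.
  apply: cycle_from_next Uc _ => x xc.
  by have := step x xc; have := none x; rewrite xc /= => /negPf->; rewrite orbF.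
have back k : p (N (iter k N x)) == iter k N x.
  elim: k => //= k /eqP IHk; set y := iter k N x in IHk *.
  have yc : y \in c by rewrite /y; elim: (k) => //= l; rewrite mem_next.
  have /step : N y \in c by rewrite mem_next.
  by rewrite IHk eq_sym (negPf (NN y yc)).
rewrite rev_cycle; apply: (cycle_from_next Uc) => y yc.
have : fconnect N x y by rewrite (fconnect_cycle (cycle_next Uc)).
by move=> /iter_findex <-; apply: back.
Qed.

Lemma cycle_edges_fcycle c : fcycle p c ->
  cycle_edges c = [set [set x; p x] | x in c].
Proof.
by move=> pc; apply: eq_in_imset => x xc; rewrite (nextE pc).
Qed.

(** By finiteness the iterate of index [order p x] repeats an earlier one, which is therefore
    periodic. *)
Lemma periodic_reachable x : exists2 y, fconnect p x y & fcycle p (orbit p y).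
Proof.
have /trajectP[i io e] := looping_order p x.
exists (iter i p x); first exact: fconnect_iter.
apply/(orbitPcycle 0 3); exists (order p x - i).-1.
by rewrite prednK ?subn_gt0 // -iterD subnK // ltnW.
Qed.

(** This is the relation of lying in the same component: orbits in one component eventually
    merge. *)
Definition meet x y := [exists z, fconnect p x z && fconnect p y z].

Lemma meetP x y :
  reflect (exists2 z, fconnect p x z & fconnect p y z) (meet x y).
Proof.
by apply: (iffP existsP) => [[z /andP[]]|[z xz yz]]; exists z => //; apply/andP.
Qed.

Lemma fconnect_comparable x y z :
  fconnect p x y -> fconnect p x z -> fconnect p y z \/ fconnect p z y.
Proof.
move=> /iter_findex<- /iter_findex<-.
set a := findex p x y; set b := findex p x z.
case/orP: (leq_total a b) => /subnK<-; rewrite iterD; [left|right];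
  exact: fconnect_iter.
Qed.

Lemma meet_equiv : equivalence_rel meet.
Proof.
have mxx x : meet x x by apply/meetP; exists x.
have mC x y : meet x y = meet y x.
  by apply: eq_existsb => z; rewrite andbC.
have mT x y z : meet x y -> meet y z -> meet x z.
  move=> /meetP[a xa ya] /meetP[b yb zb]; apply/meetP.
  case: (fconnect_comparable ya yb) => h.
    by exists b => //; apply: connect_trans h.
  by exists a => //; apply: connect_trans h.
move=> x y z; split=> // xy; apply/idP/idP; last exact: mT.
by apply: mT; rewrite mC.
Qed.

End FunctionalGraph.

(** * Functional components as unicycle oriented graphs *)

Section Components.
Variables (D : wograph T) (p : T -> T).
Hypothesis V_full : vertices D = [set: T].
Hypothesis pD : forall v, dedge D (p v) v.
Hypothesis pw : forall v, weight D (p v) != 1%N.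

Let p_asym x : p (p x) != x.
Proof.
by apply/negP => /eqP e; have := dedge_antisym (pD x); rewrite -{1}e pD.
Qed.

Section Component.
Variable B : {set T}.

(** Only the edges from [p y] to [y] are kept; the other edges of [D] inside [B] could create
    further cycles. *)
Definition component_edges : {set T * T} :=
  [set e | [&& e.1 \in B, e.2 \in B & p e.2 == e.1]].

Let component_edge_in x y :
  (x, y) \in component_edges -> (x \in B) && (y \in B).
Proof. by rewrite inE /= => /and3P[-> ->]. Qed.

Let sub_D x y : (x, y) \in component_edges -> (x, y) \in edges D.
Proof. by rewrite inE /= => /and3P[_ _ /eqP<-]; apply: pD. Qed.

Let component_irr x : (x, x) \notin component_edges.
Proof. by apply/negP => /sub_D; apply/negP; rewrite [_ \in _](dedgexx D). Qed.

Let component_asym x y :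
  (x, y) \in component_edges -> (y, x) \notin component_edges.
Proof.
move=> /sub_D/dedge_antisym/negbT; apply: contra; exact: sub_D.
Qed.

Let component_weight x : x \in B -> (0 < weight D x)%N.
Proof. by move=> _; apply: weight_gt0; rewrite V_full inE. Qed.

Definition component : wograph T :=
  WOGraph component_edge_in component_irr component_asym component_weight.

Lemma component_subgraph : subgraph component D.
Proof.
split=> //=; first by rewrite V_full subsetT.
by apply/subsetP => -[x y]; apply: sub_D.
Qed.

Lemma dedge_component x y :
  dedge component x y = [&& x \in B, y \in B & p y == x].
Proof. by rewrite /dedge /= inE. Qed.

Variable x0 : T.
Hypothesis BE : B = [set y | meet p x0 y].

Let meet_equ := meet_equiv p.

Let memB_p y : (p y \in B) = (y \in B).
Proof.
have yp : meet p y (p y) by apply/meetP; exists (p y); rewrite ?fconnect1.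
rewrite BE !inE; have [refl tr] := meet_equ (p y) y x0.
have sym a b : meet p a b = meet p b a by apply: eq_existsb => z; rewrite andbC.
by rewrite ![meet p x0 _]sym; apply: tr; rewrite sym.
Qed.

Let memB_iter k y : (iter k p y \in B) = (y \in B).
Proof. by elim: k => //= k IHk; rewrite memB_p. Qed.

Let dedge_p y : y \in B -> dedge component (p y) y.
Proof. by move=> yB; rewrite dedge_component memB_p yB /=. Qed.

Let connect_down y z : y \in B -> fconnect p y z -> connect (dedge component) z y.
Proof.
move=> yB /iter_findex<-; elim: findex => //= k IHk.
by apply: connect_trans IHk; apply/connect1/dedge_p; rewrite memB_iter.
Qed.

Let adj_sym : connect_sym (adj component).
Proof. by apply: sym_connect_sym => x y; rewrite /adj /= orbC. Qed.

Let connect_adj y z : y \in B -> fconnect p y z -> connect (adj component) z y.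
Proof.
move=> yB /(connect_down yB); apply: connect_sub => a b ab.
by apply: connect1; rewrite /adj /= ab.
Qed.

Let meetB y z : y \in B -> z \in B -> meet p y z.
Proof.
rewrite BE !inE => xy xz; have [_ tr] := meet_equ x0 y z.
by rewrite -tr.
Qed.

(** Edges run against [p]. All forward orbits in [B] end in one cycle of [p]; read backwards it is
    the oriented cycle, and reversed orbits lead from it to every vertex of [B]. *)
Lemma component_unicycle : unicycle_oriented component.
Proof.
have x0B : x0 \in B by rewrite BE inE; have [] := meet_equ x0 x0 x0.
split.
  split=> /=; first by apply/set0Pn; exists x0.
  move=> y z yB zB; have /meetP[u yu zu] := meetB yB zB.
  by apply: connect_trans (connect_adj zB zu); rewrite adj_sym connect_adj.
have [a x0a acyc] := periodic_reachable p x0.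
have aB : a \in B by have /iter_findex<- := x0a; rewrite memB_iter.
have orbB y : y \in orbit p a -> y \in B.
  by rewrite -fconnect_orbit => /iter_findex<-; rewrite memB_iter.
have adjE x y : adj component x y -> (p x == y) || (p y == x).
  by rewrite /adj /= !dedge_component => /orP[] /and3P[_ _ ->]; rewrite ?orbT.
have cyc : cycle (dedge component) (rev (orbit p a)).
  rewrite rev_cycle; apply: (cycle_from_next (orbit_uniq p a)) => y ya.
  by rewrite (nextE acyc) //; apply/dedge_p/orbB.
have und : underlying_cycle component (rev (orbit p a)).
  apply/and3P; split; last first.
  - by apply: sub_cycle cyc => x y; rewrite /adj /= => ->.
  - by rewrite rev_uniq orbit_uniq.
  (* The length is neither 1, as there are no loops, nor 2, as no two edges are opposite. *)
  rewrite size_rev size_orbit; have /(orbitPcycle 0 4) := acyc.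
  have := order_gt0 p a; case: (order p a) => [|[|[|k]]] //= _.
    by move=> e; have := dedgexx D a; rewrite -{1}e pD.
  by move=> e; have := p_asym a; rewrite e eqxx.
exists (rev (orbit p a)); split=> //.
- move=> c' und'.
  (* Up to reversal, [c'] is a cycle [d] of [p]. A common point of the forward orbits of [a] and of
     a vertex of [c'] lies on both cycles, which therefore coincide. *)
  have [d [pd dc ec]] : exists d,
      [/\ fcycle p d, d =i c' & cycle_edges c' = cycle_edges d].
    have /and3P[_ Uc _] := und'.
    have [h|h] := fcycle_of_underlying (in2W adjE) und'.
      by exists c'.
    by exists (rev c'); rewrite cycle_edges_rev //; split=> // x; rewrite mem_rev.
  rewrite ec (cycle_edges_rev (orbit_uniq p a)).
  rewrite (cycle_edges_fcycle pd) (cycle_edges_fcycle acyc).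
  have /and3P[c3 _ cc] := und'.
  have [b bc] : exists b, b \in c' by case: (c') c3 => // b ?; exists b; rewrite inE eqxx.
  have bB : b \in B.
    have := next_cycle cc bc; rewrite /adj /= !dedge_component.
    by case/orP=> /and3P[].
  have /meetP[u au bu] := meetB aB bB.
  have ua : u \in orbit p a by rewrite -fconnect_orbit.
  have ud : u \in d by rewrite -(fconnect_cycle pd (x := b)) ?dc.
  have da : d =i orbit p a.
    by move=> x; rewrite -(fconnect_cycle pd ud) -(fconnect_cycle acyc ua).
  by apply/setP => e; apply/imsetP/imsetP => -[x xd ->]; exists x; rewrite // ?da // -da.
- move=> y yB _; have /meetP[u au yu] := meetB aB yB.
  by exists u; [rewrite mem_rev -fconnect_orbit|apply: connect_down].
(* A vertex outside the image of [p] has [p x] as its only possible neighbour, so degree at least 2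
   makes [x] some [p z]. *)
move=> x _ degx; have [/existsP[z /eqP<-]|/existsPn none] := boolP [exists z, p z == x].
  exact: pw.
have /subset_leq_card : [set y | adj component x y] \subset [set p x].
  apply/subsetP => y; rewrite !inE => /adjE; rewrite (negPf (none y)) orbF.
  by rewrite eq_sym.
by rewrite cards1 leqNgt; case/negP.
Qed.

End Component.

Lemma component_partition : (0 < #|T|)%N -> unicycle_partition D.
Proof.
case/card_gt0P => t _; pose P := equivalence_partition (meet p) [set: T].
have PP : partition P [set: T].
  by apply: equivalence_partitionP => x y z _ _ _; apply: meet_equiv.
have PF : [set vertices (component (enum_val i)) | i : 'I_#|P|] = P.
  apply/setP => B; apply/imsetP/idP => [[i _ ->]|BP]; first exact: enum_valP.
  by exists (enum_rank_in BP B); rewrite //= enum_rankK_in.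
exists #|P|, (fun i => component (enum_val i)); split.
- apply/card_gt0P; exists (pblock P t); apply: pblock_mem.
  by rewrite (cover_partition PP) inE.
- move=> i; split; first exact: component_subgraph.
  have /imsetP[x _ e] := enum_valP i; apply: (@component_unicycle _ x).
  by rewrite e; apply/setP => y; rewrite !inE.
- by move=> i j /= /enum_val_inj.
by rewrite PF V_full.
Qed.

End Components.

Lemma unicycle_partitionP D : vertices D = [set: T] ->
  unicycle_partition D <-> (0 < #|T|)%N && all_dominated D.
Proof.
move=> V_full; split=> [/(unicycle_partition_dominated V_full)/andP //|].
case/andP=> T0 /forallP dom.
have [p pP] := choice (fun v => existsP (dom v)).
by apply: (component_partition V_full (p := p)) => // v; have /andP[] := pP v.
Qed.

End GraphCycles.

(** * Ideals and chains of primes *)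

Section IdealFacts.
Variable A : comNzRingType.

Definition mk_ideal (S : A -> bool) (S_ideal : idealr_closed S) : idealr A :=
  HB.pack S (isIdealr.Build A S S_ideal).

Definition mk_prime (S : A -> bool) (S_ideal : idealr_closed S)
    (S_prime : prime_idealr_closed S) : prime_idealr A :=
  HB.pack S (isIdealr.Build A S S_ideal) (isPrimeIdealrClosed.Build A S S_prime).

Lemma idealD (I : idealr A) a b : a \in I -> b \in I -> a + b \in I.
Proof. exact: rpredD. Qed.

Lemma idealrMl (I : idealr A) a b : a \in I -> a * b \in I.
Proof. by rewrite mulrC; apply: idealMr. Qed.

Lemma idealr_linear (I : idealr A) : idealr_closed I.
Proof.
split=> [||a u v uI vI]; [exact: idealr0|by rewrite idealr1|].
by rewrite rpredD ?idealMr.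
Qed.

Lemma prime_idealrX (P : prime_idealr A) a k : a ^+ k \in P -> a \in P.
Proof.
elim: k => [|k IHk]; first by rewrite expr0 idealr1.
by rewrite exprS prime_idealrM => /orP[|/IHk].
Qed.

(* An ideal maximal among those that avoid the powers of [s] is prime. *)
Lemma prime_avoiding (J : {pred A}) s :
    0 \in J -> (forall a, {in J &, forall u v, a * u + v \in J}) ->
    (forall k, s ^+ k \notin J) ->
  exists2 P : prime_idealr A, {subset J <= P} & s \notin P.
Proof.
move=> J0 Jlin sJ.
(* Zorn's lemma is applied to all chains, including the empty one, so [J] is adjoined to [X] instead
   of being required to lie in it. *)
pose U (X : A -> Prop) := fun a => X a \/ a \in J.
pose good (X : A -> Prop) :=
  (forall a u v, U X u -> U X v -> U X (a * u + v)) /\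
  (forall k, ~ U X (s ^+ k)).
have [F goodF totF|X [[Xlin Xs] Xmax]] := @classical_sets.Zorn_bigcup A good.
  split=> [a u v|k].
    move=> [[X FX Xu]|uJ] [[Y FY Yv]|vJ].
    - have [XY|YX] := totF _ _ FX FY.
        have [aY|] := (goodF _ FY).1 a u v (or_introl (XY _ Xu)) (or_introl Yv).
          by left; exists Y.
        by right.
      have [aX|] := (goodF _ FX).1 a u v (or_introl Xu) (or_introl (YX _ Yv)).
        by left; exists X.
      by right.
    - have [aX|] := (goodF _ FX).1 a u v (or_introl Xu) (or_intror vJ).
        by left; exists X.
      by right.
    - have [aY|] := (goodF _ FY).1 a u v (or_intror uJ) (or_introl Yv).
        by left; exists Y.
      by right.
    - by right; apply: Jlin.
  by case=> [[X FX Xk]|]; [apply: ((goodF _ FX).2 k); left|apply/negP].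
pose S a := `[< U X a >].
have S0 : 0 \in S by apply/asboolP; right.
have Slin a : {in S &, forall u v, a * u + v \in S}.
  by move=> u v /asboolP uX /asboolP vX; apply/asboolP/Xlin.
have SM a u : u \in S -> a * u \in S.
  by move=> uS; rewrite -[_ * _]addr0 Slin.
(* By maximality, the ideal spanned by [S] and any [u] outside it contains a power of [s]. *)
have extend u : u \notin S -> exists k a x, x \in S /\ s ^+ k = a * u + x.
  move=> uS; apply: contrapT => noext.
  pose Y b := exists a x, x \in S /\ b = a * u + x.
  have XY b : U X b -> Y b.
    by move=> Xb; exists 0, b; rewrite mul0r add0r; split=> //; apply/asboolP.
  have YU b : U Y b -> Y b.
    by case=> // bJ; apply: XY; right.
  apply: (Xmax Y).
    split=> [b Xb|YX]; first by apply: XY; left.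
    have /YX Xu : Y u by exists 1, 0; rewrite mul1r addr0.
    by case/asboolP: uS; left.
  split=> [a b c /YU[b1 [b2 [b2S ->]]] /YU[c1 [c2 [c2S ->]]]|k /YU[a [x [xS e]]]].
    left; exists (a * b1 + c1), (a * b2 + c2); split; first exact: Slin.
    by ring.
  by apply: noext; exists k, a, x.
have S_ideal : idealr_closed S.
  split=> //; apply/asboolP; have := Xs 0%N; by rewrite expr0.
have S_prime : prime_idealr_closed S.
  move=> u v uvS; apply/negPn/negP; rewrite negb_or => /andP[].
  move=> /extend[k [a [x [xS ek]]]] /extend[l [b [y [yS el]]]].
  apply: (Xs (k + l)%N); apply/asboolP; rewrite exprD ek el.
  have -> : (a * u + x) * (b * v + y) =
      (a * b) * (u * v) + ((b * v + y) * x + (a * u) * y) by ring.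
  by apply: (Slin) => //; apply: (Slin) => //; apply: SM.
exists (mk_prime S_ideal S_prime) => [a aJ|]; first by apply/asboolP; right.
by apply/asboolP; have := Xs 1%N; rewrite expr1.
Qed.

(** The top [c d] is replaced by the larger [c' 0], so the step into the junction stays strict and
    no length is lost. *)
Lemma prime_chain_cat d e (c c' : nat -> prime_idealr A) :
    prime_chain d c -> prime_chain e c' ->
    {subset c d <= c' 0%N} ->
  exists2 c2, prime_chain (d + e) c2 & c2 (d + e)%N =i c' e.
Proof.
move=> cd ce cc'.
pose c2 i := if (i < d)%N then c i else c' (i - d)%N.
exists c2; last by rewrite /c2 ltnNge leq_addr /= addKn.
move=> i ide; rewrite /c2.
case: (ltngtP i d) => id.
- have [iS|] := ltnP i.+1 d; first by apply: cd.
  move=> di; have -> : (i.+1 - d = 0)%N by apply/eqP; rewrite subn_eq0.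
  have e1 : d = i.+1 by apply/eqP; rewrite eqn_leq di id.
  have [h1 h2] := cd i id; split=> [a /h1|h3]; first by rewrite -e1; apply: cc'.
  by apply: h2 => a; rewrite -e1 => /cc'; apply: h3.
- rewrite ltnNge (leq_trans (ltnW id)) //=.
  rewrite subSn ?(ltnW id) //; apply: ce.
  by rewrite ltn_subLR // ltnW.
- rewrite -id ltnNge leqnSn /= subnn subSn // subnn; apply: ce.
  by move: ide; rewrite id -addn1 leq_add2l.
Qed.

(** Height is a relation here; a bound on the chains ending in [P] provides a longest one. *)
Lemma has_height_exists (P : prime_idealr A) b :
  (forall k c, prime_chain k c -> c k =i P -> (k <= b)%N) ->
  exists d, has_height P d.
Proof.
move=> bound.
pose good k := `[< exists2 c, prime_chain k c & c k =i P >].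
have ex : exists k, good k by exists 0%N; apply/asboolP; exists (fun=> P).
have ub k : good k -> (k <= b)%N by case/asboolP=> c; apply: bound.
case: (ex_maxnP ex ub) => d /asboolP gd maxd; exists d; split=> // k c ck cP.
by apply: maxd; apply/asboolP; exists c.
Qed.

End IdealFacts.

(** * Localizations of quotient rings *)

Section LocalizedQuotient.
Variables (R L : comNzRingType) (f : {rmorphism R -> L}).
Variables (I : idealr R) (M : prime_idealr R).

(* [f] exhibits [L] as the localization of [R / I] at the image of [M]. *)
Definition localizes_quotient :=
  [/\ {subset I <= M},
      forall y, exists a s, s \notin M /\ y * f s = f a,
      forall s, s \notin M -> exists t, f s * t = 1 &
      forall a, f a = 0 <-> exists2 u, u \notin M & u * a \in I].

Hypothesis loc : localizes_quotient.

Let IM : {subset I <= M}. Proof. by case: loc. Qed.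
Let fracL y : exists a s, s \notin M /\ y * f s = f a.
Proof. by case: loc. Qed.
Let unitL s : s \notin M -> exists t, f s * t = 1.
Proof. by move: s; case: loc. Qed.
Let kerL a : f a = 0 <-> exists2 u, u \notin M & u * a \in I.
Proof. by case: loc. Qed.

(** For an ideal [P], this is the ideal generated by its image, described by fractions with
    numerator in [P]. *)
Definition extension (P : {pred R}) (y : L) : bool :=
  `[< exists a s, [/\ a \in P, s \notin M & y * f s = f a] >].

Lemma cancel_unitL s x y : s \notin M -> x * f s = y * f s -> x = y.
Proof.
move=> /unitL[t st] e; rewrite -[x]mulr1 -[y]mulr1 -st.
by rewrite !mulrA e.
Qed.

Section ExtensionPrime.
Variable P : prime_idealr R.
Hypotheses (IP : {subset I <= P}) (PM : {subset P <= M}).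

Let notinP s : s \notin M -> s \notin P.
Proof. by apply: contra => /PM. Qed.

(** Denominators avoid [M], hence [P], and primality of [P] cancels them. *)
Lemma mem_extension a : (f a \in extension P) = (a \in P).
Proof.
apply/asboolP/idP => [[b [s [bP sM]]]|aP]; last first.
  by exists a, 1; rewrite idealr1 rmorph1 mulr1.
rewrite -rmorphM => /eqP; rewrite -subr_eq0 -rmorphB => /eqP/kerL[u uM /IP].
rewrite prime_idealrM (negPf (notinP uM)) /= => h.
have : a * s \in P by rewrite -[a * s](subrK b) rpredD.
by rewrite prime_idealrM (negPf (notinP sM)) orbF.
Qed.

Lemma extension_ideal : idealr_closed (extension P).
Proof.
split; first by have := mem_extension 0; rewrite rmorph0 idealr0.
  by have := mem_extension 1; rewrite rmorph1 idealr1 => ->.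
move=> x u v /asboolP[b [s [bP sM us]]] /asboolP[c [t [cP tM vt]]].
have [a [r [rM xr]]] := fracL x.
apply/asboolP; exists (a * b * t + c * (r * s)), (r * s * t).
split; [by apply: idealD; [apply/idealrMl/idealMr|apply/idealrMl]| |].
  by rewrite !Localization.notinM.
rewrite rmorphD !rmorphM -us -vt -xr; ring.
Qed.

Lemma extension_prime : prime_idealr_closed (extension P).
Proof.
move=> u v uvP; have [a [s [sM us]]] := fracL u.
have [b [t [tM vt]]] := fracL v.
have : f (a * b) \in extension P.
  have -> : f (a * b) = f (s * t) * (u * v) + 0.
    by rewrite addr0 !rmorphM -us -vt; ring.
  have [E0 _ Elin] := extension_ideal; exact: Elin.
rewrite mem_extension prime_idealrM => /orP[aP|bP]; apply/orP.
  by left; apply/asboolP; exists a, s.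
by right; apply/asboolP; exists b, t.
Qed.

Definition ext_prime : prime_idealr L :=
  mk_prime extension_ideal extension_prime.

Lemma mem_ext_prime a : (f a \in ext_prime) = (a \in P).
Proof. exact: mem_extension. Qed.

End ExtensionPrime.

Lemma contraction_ideal (Q : idealr L) : idealr_closed (fun a => f a \in Q).
Proof.
have inE a : (a \in (fun a => f a \in Q)) = (f a \in Q) by [].
split=> [||a u v]; rewrite !inE ?rmorph0 ?idealr0 ?rmorph1 ?idealr1 //.
by move=> uQ vQ; rewrite rmorphD rmorphM rpredD // idealMr.
Qed.

Lemma contraction_prime (Q : prime_idealr L) :
  prime_idealr_closed (fun a => f a \in Q).
Proof.
have inE a : (a \in (fun a => f a \in Q)) = (f a \in Q) by [].
by move=> u v; rewrite !inE rmorphM prime_idealrM.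
Qed.

Definition contraction (Q : prime_idealr L) : prime_idealr R :=
  mk_prime (contraction_ideal Q) (@contraction_prime Q).

Lemma mem_contraction Q a : (a \in contraction Q) = (f a \in Q).
Proof. by []. Qed.

Lemma sub_contraction Q : {subset I <= contraction Q}.
Proof.
move=> a aI; rewrite mem_contraction (kerL a).2 ?idealr0 //.
by exists 1; rewrite ?idealr1 ?mul1r.
Qed.

(** An element outside [M] maps to a unit, and an [idealr] is proper. *)
Lemma contraction_sub (Q : idealr L) a : f a \in Q -> a \in M.
Proof.
move=> aQ; apply/negPn/negP => /unitL[t at1].
by have := idealMr t aQ; rewrite mulrC at1 idealr1.
Qed.

(** Up to a unit every element of [L] comes from [R]. Hence contraction reflects inclusions and
    keeps chains strict. *)
Lemma contraction_mono (Q Q' : idealr L) :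
  (forall a, f a \in Q -> f a \in Q') -> {subset Q <= Q'}.
Proof.
move=> sQ y yQ; have [a [s [sM ys]]] := fracL y.
have /sQ : f a \in Q by rewrite -ys idealrMl.
rewrite -ys; have [t st] := unitL sM => /(idealMr t).
by rewrite mulrC -mulrA st mulr1.
Qed.

Lemma contraction_chain d c :
  prime_chain d c -> prime_chain d (fun i => contraction (c i)).
Proof.
move=> cd i /cd[s1 s2]; split=> [a|s3]; first by rewrite !mem_contraction => /s1.
by apply: s2; apply: contraction_mono => a; apply: s3.
Qed.

Let MM : {subset M <= M}. Proof. by []. Qed.

Definition local_max : prime_idealr L := ext_prime IM MM.

Lemma mem_local_max a : (f a \in local_max) = (a \in M).
Proof. exact: mem_ext_prime. Qed.

Lemma sub_local_max (Q : idealr L) : {subset Q <= local_max}.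
Proof.
by apply: contraction_mono => a /contraction_sub; rewrite mem_local_max.
Qed.

Lemma local_max_maximal : maximal_ideal local_max.
Proof. by move=> J _; apply: sub_local_max. Qed.

Lemma local_max_unique (m : idealr L) : maximal_ideal m -> m =i local_max.
Proof.
move=> mmax a; apply/idP/idP; first exact: sub_local_max.
by apply: mmax; apply: sub_local_max.
Qed.

Lemma has_krull_dim_ge1 d (P : prime_idealr R) :
    {subset I <= P} -> {subset P <= M} -> ~ {subset M <= P} ->
  has_krull_dim L d -> (1 <= d)%N.
Proof.
move=> IP PM MP [_ ub].
apply: (ub _ (fun i => if i is 0 then ext_prime IP PM else local_max)).
case=> // _; split; first exact: sub_local_max.
move=> h; apply: MP => a aM.
by rewrite -(mem_ext_prime IP PM) h // mem_local_max.
Qed.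

End LocalizedQuotient.

(** * Generated ideals and regular sequences *)

Section IdealGen.
Variable A : comNzRingType.

Lemma mem_ideal_gen_nil (b : A) : (b \in ideal_gen [::]) = (b == 0).
Proof.
apply/asboolP/eqP => [[c ->]|->]; first by rewrite big_ord0.
by exists (fun=> 0); rewrite big_ord0.
Qed.

Lemma mem_ideal_gen1 (a b : A) :
  reflect (exists c, b = c * a) (b \in ideal_gen [:: a]).
Proof.
apply: (iffP (asboolP _)) => [[c ->]|[c ->]].
  by exists (c ord0); rewrite big_ord1.
by exists (fun=> c); rewrite big_ord1.
Qed.

Lemma mem_ideal_gen s (a : A) : a \in s -> a \in ideal_gen s.
Proof.
move=> /(nthP 0)[i si <-]; apply/asboolP.
exists (fun j : 'I_(size s) => (j == Ordinal si)%:R).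
rewrite (bigD1 (Ordinal si)) //= eqxx mul1r big1 ?addr0 // => j /negPf->.
by rewrite mul0r.
Qed.

Lemma ideal_gen_sub s (J : {pred A}) :
    0 \in J -> (forall a, {in J &, forall u v, a * u + v \in J}) ->
  {subset s <= J} -> {subset ideal_gen s <= J}.
Proof.
move=> J0 Jlin sJ b /asboolP[c ->].
apply: (big_ind (fun x => x \in J)) => //.
  by move=> x y xJ yJ; rewrite -[x]mul1r Jlin.
by move=> i _; rewrite -[_ * _]addr0 Jlin // sJ // mem_nth.
Qed.

Lemma regular_sequence_head (a : A) s b :
  regular_sequence (a :: s) -> a * b = 0 -> b = 0.
Proof.
case=> _ /(_ 0%N isT b); rewrite take0 !mem_ideal_gen_nil /= => reg /eqP ab.
exact/eqP/reg.
Qed.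

End IdealGen.

(** * Depth of the local rings *)

Section LocalDepth.
Variables (R L : comNzRingType) (f : {rmorphism R -> L}).
Variables (I : idealr R) (M : prime_idealr R).
Hypothesis loc : localizes_quotient f I M.

(** The maximal ideal kills the nonzero element [f w], so the depth is 0, while [P] strictly below
    [M] makes the dimension at least 1. *)
Lemma not_cm_local (P : prime_idealr R) w :
    {subset I <= P} -> {subset P <= M} -> ~ {subset M <= P} ->
    (forall g, g \in M -> g * w \in I) -> (forall u, u \notin M -> u * w \notin I) ->
  ~ cohen_macaulay_local L.
Proof.
move=> IP PM MP Mw wI [m [mmax _ [d [[s [sreg sm sd]] _] dim]]].
have d1 := has_krull_dim_ge1 loc IP PM MP dim.
case: s sreg sm sd => [|s0 s] reg sm sd; first by rewrite -sd in d1.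
have [IM fracL unitL kerL] := loc.
have fw0 : f w <> 0 by move=> /kerL[u /wI]; move/negP.
apply: fw0; apply: (regular_sequence_head reg).
have s0m := sm s0 (mem_head _ _); have [a [t [tM e]]] := fracL s0.
apply: (cancel_unitL loc tM); rewrite mul0r mulrAC e -rmorphM.
apply/kerL; exists 1; rewrite ?idealr1 // mul1r Mw //.
by rewrite -(mem_local_max loc) -e idealrMl // -(local_max_unique loc mmax).
Qed.

(* A second element [s1] of a regular sequence starting with [s0] would have no
   power in [(s0)], hence miss a prime over [s0]; such a prime is strictly below
   [M], so it consists of zero divisors. *)
Lemma cm_local_dim1 (P : prime_idealr R) t :
    {subset I <= P} -> {subset P <= M} -> ~ {subset M <= P} ->
    (forall k c, prime_chain k c -> {subset I <= c 0%N} -> {subset c k <= M} ->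
      (k <= 1)%N) ->
    t \in M -> (forall b, t * b \in I -> b \in I) ->
    (forall Q : prime_idealr R, {subset I <= Q} -> {subset Q <= M} ->
       ~ {subset M <= Q} -> forall a, a \in Q ->
       exists2 b, a * b \in I & forall u, u \notin M -> u * b \notin I) ->
  cohen_macaulay_local L.
Proof.
move=> IP PM MP dim tM treg zd.
have [IM fracL unitL kerL] := loc.
exists (local_max loc); split; first exact: local_max_maximal.
  exact: local_max_unique.
exists 1%N; last first.
  split; last first.
    move=> k c ck; apply: (dim k (fun i => contraction f (c i))).
    - exact: (contraction_chain loc).
    - exact: (sub_contraction loc).
    - by move=> a; apply: (contraction_sub loc).
  exists (fun i => if i is 0 then ext_prime loc IP PM else local_max loc).
  case=> // _; split; first exact: sub_local_max.
  move=> h; apply: MP => a aM.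
  by rewrite -(mem_ext_prime loc IP PM) h // mem_local_max.
split.
  exists [:: f t]; split=> //; last first.
    by move=> _ /[!inE]/eqP->; rewrite mem_local_max.
  split.
    apply/mem_ideal_gen1 => -[c e].
    have /(idealMr c) : f t \in local_max loc by rewrite mem_local_max.
    by rewrite -e idealr1.
  case=> // _ b; rewrite take0 !mem_ideal_gen_nil /= => /eqP tb.
  have [a [s [sM e]]] := fracL b; have /kerL[u uM] : f (t * a) = 0.
    by rewrite rmorphM -e mulrA tb mul0r.
  rewrite mulrCA => /treg uaI; apply/eqP; apply: (cancel_unitL loc sM).
  by rewrite e mul0r; apply/kerL; exists u.
case=> [|s0 [|s1 s]] // reg sm; exfalso; have [s1N sreg] := reg.
have s0m : s0 \in local_max loc by apply: sm; rewrite inE eqxx.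
have s1m : s1 \in local_max loc by apply: sm; rewrite !inE eqxx orbT.
have s1reg b : s1 * b \in ideal_gen [:: s0] -> b \in ideal_gen [:: s0].
  exact: (sreg 1%N isT b).
have s1X k : s1 ^+ k \notin ideal_gen [:: s0].
  elim: k => [|k IHk]; last by rewrite exprS; apply: contra IHk => /s1reg.
  apply: contra s1N; rewrite expr0; apply: ideal_gen_sub.
  - exact: ideal_gen0.
  - exact: ideal_gen_linear.
  - by move=> x /[!inE]/eqP->; apply: mem_ideal_gen; rewrite inE eqxx.
have [Q s0Q s1Q] := prime_avoiding (ideal_gen0 _) (@ideal_gen_linear _ _) s1X.
have /s0Q{}s0Q : s0 \in ideal_gen [:: s0] by apply: mem_ideal_gen; rewrite inE.
have [a [r [rM e]]] := fracL s0.
have aQ : a \in contraction f Q by rewrite -[_ \in _]/(f a \in Q) -e idealrMl.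
have MQ : ~ {subset M <= contraction f Q}.
  move=> sMQ; move/negP: s1Q; apply.
  apply: (contraction_mono loc) s1m => x; rewrite mem_local_max.
  exact: sMQ.
(* Here [b] kills the numerator [a] of [s0] although [f b] is nonzero, against the regularity of
   [s0]. *)
have [||b abI bN] := zd (contraction f Q) _ _ MQ a aQ.
- exact: (sub_contraction loc).
- by move=> x; apply: (contraction_sub loc).
have fab : f (a * b) = 0 by apply/kerL; exists 1; rewrite ?idealr1 ?mul1r.
have /(regular_sequence_head reg) fb : s0 * f b = 0.
  by apply: (cancel_unitL loc rM); rewrite mul0r mulrAC e -rmorphM.
by have /kerL[u /bN/negP] := fb.
Qed.

End LocalDepth.

(** * The localization map *)

Section LocalizationMap.
Variables (A : comNzRingType) (P : prime_idealr A).

Definition loc_map (a : A) : localization P :=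
  \pi_(Localization.type P) (Localization.ofring P a).

Lemma loc_map_is_zmod_morphism : zmod_morphism loc_map.
Proof.
move=> a b.
have -> : loc_map a - loc_map b =
    Localization.add (loc_map a) (Localization.opp (loc_map b)) by [].
rewrite /loc_map -Localization.pi_opp -Localization.pi_add.
apply/eqP/Localization.equivlP => /=; exists 1; first exact: Localization.notin1.
by ring.
Qed.

Lemma loc_map_is_monoid_morphism : monoid_morphism loc_map.
Proof.
split=> // a b.
have -> : loc_map a * loc_map b = Localization.mul (loc_map a) (loc_map b) by [].
rewrite /loc_map -Localization.pi_mul.
apply/eqP/Localization.equivlP => /=; exists 1; first exact: Localization.notin1.
by ring.
Qed.

HB.instance Definition _ :=
  GRing.isZmodMorphism.Build A (localization P) loc_map loc_map_is_zmod_morphism.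
HB.instance Definition _ :=
  GRing.isMonoidMorphism.Build A (localization P) loc_map
    loc_map_is_monoid_morphism.

Lemma loc_mapP (y : localization P) :
  exists a s, s \notin P /\ y * loc_map s = loc_map a.
Proof.
elim/quotW: y => -[[a s] sP]; exists a, s; split=> //.
set y := \pi _; have -> : y * loc_map s = Localization.mul y (loc_map s) by [].
rewrite /y /loc_map -Localization.pi_mul.
apply/eqP/Localization.equivlP => /=; exists 1; first exact: Localization.notin1.
by ring.
Qed.

Lemma loc_map_unit s : s \notin P -> exists t, loc_map s * t = 1.
Proof.
move=> sP; exists (\pi_(Localization.type P) (@Localization.Dom _ _ (1, s) sP)).
set y := \pi _; have -> : loc_map s * y = Localization.mul (loc_map s) y by [].
rewrite /y /loc_map -Localization.pi_mul.
apply/eqP/Localization.equivlP => /=; exists 1; first exact: Localization.notin1.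
by ring.
Qed.

Lemma loc_map_eq0 a : loc_map a = 0 <-> exists2 u, u \notin P & u * a = 0.
Proof.
have -> : (0 : localization P) = loc_map 0 by rewrite raddf0.
split=> [/eqP/Localization.equivlP /=|] [u uP e].
  by exists u; rewrite // -[a]mulr1 e mul0r mulr0.
by apply/eqP/Localization.equivlP; exists u; rewrite //= mulr1 e mul0r mulr0.
Qed.

End LocalizationMap.

Section QuotientLocalization.
Variables (R : comNzRingType) (I : idealr R).
Let A : comNzRingType := {ideal_quot I}.
Let pi (a : R) : A := \pi_({ideal_quot I}) a.

Let pi_zmod : zmod_morphism pi.
Proof. by move=> a b; rewrite /pi rmorphB. Qed.
Let pi_mon : monoid_morphism pi.
Proof. by split=> [|a b]; rewrite /pi ?rmorph1 ?rmorphM. Qed.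

Definition quot_map : {rmorphism R -> A} :=
  HB.pack pi (GRing.isZmodMorphism.Build R A pi pi_zmod)
    (GRing.isMonoidMorphism.Build R A pi pi_mon).

Lemma quot_map_eq0 a : (quot_map a == 0) = (a \in I).
Proof.
have -> : (0 : A) = quot_map 0 by rewrite rmorph0.
by rewrite -[a in RHS]subr0 Quotient.idealrBE.
Qed.

Lemma quot_mapP (x : A) : exists a, x = quot_map a.
Proof. by exists (repr x); rewrite /quot_map /= /pi reprK. Qed.

End QuotientLocalization.

(** * Primes and localizations of a quotient ring *)

Section QuotientPrimes.
Variables (R : comNzRingType) (I : idealr R).
Let A : comNzRingType := {ideal_quot I}.
Let q : {rmorphism R -> A} := quot_map I.

Lemma noetherian_quotient : noetherian R -> noetherian A.
Proof.
move=> noeth J.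
pose S := mk_ideal (contraction_ideal q J).
have [s Ss] := noeth S.
exists [seq q a | a <- s] => x; apply/idP/idP.
  have [a ->] := quot_mapP x => aJ.
  have : a \in S by [].
  rewrite Ss => /asboolP[c ->]; rewrite rmorph_sum.
  apply: (big_ind (fun y => y \in ideal_gen [seq q a | a <- s])).
  - exact: ideal_gen0.
  - by move=> u v uS vS; rewrite -[u]mul1r ideal_gen_linear.
  move=> i _; rewrite -[q _]addr0 rmorphM ideal_gen_linear ?ideal_gen0 //.
  by apply/mem_ideal_gen/map_f/mem_nth.
apply: ideal_gen_sub.
- exact: idealr0.
- by case: (idealr_linear J).
by move=> _ /mapP[a /mem_ideal_gen + ->]; rewrite -Ss.
Qed.

Section Image.
Variable J : idealr R.
Hypothesis IJ : {subset I <= J}.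

Definition quot_image (x : A) : bool := `[< exists2 a, a \in J & x = q a >].

Lemma mem_quot_image a : (q a \in quot_image) = (a \in J).
Proof.
apply/asboolP/idP => [[b bJ /eqP]|aJ]; last by exists a.
rewrite -subr_eq0 -rmorphB quot_map_eq0 => /IJ abJ.
by rewrite -[a](subrK b) rpredD.
Qed.

Lemma quot_image_ideal : idealr_closed quot_image.
Proof.
split; first by have := mem_quot_image 0; rewrite rmorph0 idealr0.
  by have := mem_quot_image 1; rewrite rmorph1 idealr1 => ->.
move=> x u v; have [a ->] := quot_mapP x; have [b ->] := quot_mapP u.
have [c ->] := quot_mapP v; rewrite -rmorphM -rmorphD !mem_quot_image => bJ cJ.
by rewrite rpredD ?idealMr.
Qed.

End Image.

Section ImagePrime.
Variable P : prime_idealr R.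
Hypothesis IP : {subset I <= P}.

Lemma quot_image_prime : prime_idealr_closed (quot_image P).
Proof.
move=> u v; have [a ->] := quot_mapP u; have [b ->] := quot_mapP v.
by rewrite -rmorphM !mem_quot_image // prime_idealrM.
Qed.

Definition quot_prime : prime_idealr A :=
  mk_prime (quot_image_ideal IP) quot_image_prime.

Lemma mem_quot_prime a : (q a \in quot_prime) = (a \in P).
Proof. exact: mem_quot_image. Qed.

End ImagePrime.

(** Otherwise the image of [J] would be a proper ideal strictly above [m]. *)
Lemma contraction_maximal (m : prime_idealr A) (P J : prime_idealr R) :
    maximal_ideal m -> {subset I <= J} -> {subset P <= J} -> ~ {subset J <= P} ->
  ~ {subset contraction q m <= P}.
Proof.
move=> mmax IJ PJ JP mP; apply: JP => a aJ; apply: (mP).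
rewrite mem_contraction; apply: (mmax (quot_prime IJ)); last first.
  by rewrite mem_quot_prime.
move=> x; have [b ->] := quot_mapP x => bm; rewrite mem_quot_prime.
by apply/PJ/mP.
Qed.

Lemma quot_prime_maximal (P : prime_idealr R) (IP : {subset I <= P}) :
  maximal_ideal P -> maximal_ideal (quot_prime IP).
Proof.
move=> Pmax J PJ x; have [a ->] := quot_mapP x => aJ.
rewrite mem_quot_prime; apply: (Pmax (mk_ideal (contraction_ideal q J))) aJ => b.
by rewrite -(mem_quot_prime IP) => /PJ.
Qed.

Lemma localization_quotient (m : prime_idealr A) :
  localizes_quotient (loc_map m \o q) I (contraction q m).
Proof.
split=> [a aI|y|s sm|a].
- rewrite mem_contraction; have := quot_map_eq0 I a; rewrite aI => /eqP->.
  exact: idealr0.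
- have [x [z [zm e]]] := loc_mapP y.
  have [a xa] := quot_mapP x; have [s zs] := quot_mapP z.
  exists a, s; rewrite mem_contraction -zs; split=> //.
  by rewrite /= -/q -zs -xa.
- exact: loc_map_unit.
split=> [/loc_map_eq0[z zm e]|[u um uaI]].
  have [u zu] := quot_mapP z; exists u; first by rewrite mem_contraction -zu.
  by rewrite -quot_map_eq0 rmorphM -zu e.
apply/loc_map_eq0; exists (q u) => //.
by apply/eqP; rewrite -rmorphM quot_map_eq0.
Qed.

End QuotientPrimes.

(** * Ideals of polynomial rings *)

Section PrimeChainBound.
Variables (K : fieldType) (n : nat).
Local Notation R := {mpoly K[n]}.

(** This is linear independence over [K] of the classes of [g] in the quotient by [Q]. *)
Definition indep_mod (Q : {pred R}) (T : finType) (g : T -> R) :=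
  forall a : T -> K, \sum_t a t *: g t \in Q -> forall t, a t = 0.

(** All exponents of a monomial of degree less than [b] are less than [b]. *)
Lemma card_bmultinom_le b : (#|{: 'X_{1..n < b}}| <= b ^ n)%N.
Proof.
case: b => [|b].
  rewrite (_ : #|_| = 0)%N //; apply/eqP/pred0P => m.
  by have := bmdeg m.
pose h (m : 'X_{1..n < b.+1}) : {ffun 'I_n -> 'I_b.+1} := [ffun i => inord (m i)].
have : injective h.
  move=> m m' /ffunP e; apply/val_inj/mnmP => i.
  have lt (x : 'X_{1..n < b.+1}) : (x i < b.+1)%N.
    apply: leq_ltn_trans (bmdeg x).
    by rewrite mdegE (bigD1 i) //= leq_addr.
  by have /(congr1 (@nat_of_ord _)) := e i; rewrite !ffunE !inordK.
by move=> /leq_card; rewrite card_ffun !card_ord.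
Qed.

(** The [g t] lie in the span of the monomials of degree less than [b]; with more polynomials than
    monomials, the coefficient matrix has a nonzero left kernel, which is a linear relation. *)
Lemma indep_card (Q : idealr R) (T : finType) (g : T -> R) b :
    indep_mod Q g -> (forall t, msize (g t) <= b)%N ->
  (#|T| <= b ^ n)%N.
Proof.
move=> gQ gb; apply: leq_trans (card_bmultinom_le b).
rewrite leqNgt; apply/negP => ltT.
pose W := \matrix_(i < #|T|, j < #|{: 'X_{1..n < b}}|)
  (g (enum_val i))@_(enum_val j : 'X_{1..n < b}).
have /rowV0Pn[v /sub_kermxP vW v0] : kermx W != 0.
  rewrite -mxrank_eq0 mxrank_ker subn_eq0 -ltnNge.
  exact: leq_ltn_trans (rank_leq_col W) ltT.
suff sum0 : \sum_t v 0 (enum_rank t) *: g t = 0.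
  case/eqP: v0; apply/rowP => j; rewrite mxE -(enum_valK j).
  by apply: (gQ (fun t => v 0 (enum_rank t))); rewrite sum0 idealr0.
apply/mpolyP => m; rewrite mcoeff0 raddf_sum /=.
have [mb|bm] := ltnP (mdeg m) b; last first.
  rewrite big1 // => t _; rewrite mcoeffZ memN_msupp_eq0 ?mulr0 //.
  by apply: msize_mdeg_ge; apply: leq_trans (gb t) bm.
have /rowP/(_ (enum_rank (BMultinom mb))) := vW; rewrite !mxE => e.
rewrite -[RHS]e (reindex (fun i : 'I_#|T| => enum_val i)) /=; last first.
  by apply: onW_bij; apply: enum_val_bij.
apply: eq_bigr => i _; rewrite mcoeffZ enum_valK !mxE.
by rewrite enum_rankK.
Qed.

(** In a relation modulo [Q], factor out the lowest power of [h]: as [h] is not in the prime [Q],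
    the cofactor lies in [Q], hence in [Q']. Since [h] is in [Q'], its lowest coefficient [G i] is
    there too, and independence of [g] makes that vanish. *)
Lemma indep_mod_powers (Q Q' : prime_idealr R) h N (T : finType) (g : T -> R) :
    {subset Q <= Q'} -> h \in Q' -> h \notin Q -> indep_mod Q' g ->
  indep_mod Q (fun x : 'I_N * T => h ^+ x.1 * g x.2).
Proof.
move=> QQ' hQ' hQ gQ' a.
pose G (i : 'I_N) := \sum_t a (i, t) *: g t.
have -> : \sum_x a x *: (h ^+ x.1 * g x.2) = \sum_(i < N) h ^+ i * G i.
  transitivity (\sum_(i < N) \sum_t a (i, t) *: (h ^+ i * g t)).
    by rewrite pair_bigA; apply: eq_bigr => -[i t] _.
  by apply: eq_bigr => i _; rewrite mulr_sumr; apply: eq_bigr => t _; rewrite scalerAr.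
move=> GQ [i t].
suff IH k (j : 'I_N) : (j < k)%N -> forall t, a (j, t) = 0 by exact: (IH i.+1).
elim: k {i t} j => // k IHk i; rewrite ltnS => ik.
apply: (gQ' (fun t => a (i, t))).
rewrite -/(G i).
have G0 (j : 'I_N) : (j < i)%N -> G j = 0.
  move=> ji; rewrite /G big1 // => t _.
  by rewrite (IHk j) ?scale0r // (leq_trans ji).
have : h ^+ i * (\sum_(j : 'I_N | (i <= j)%N) h ^+ (j - i) * G j) \in Q.
  rewrite mulr_sumr (eq_bigr (fun j : 'I_N => h ^+ j * G j)); last first.
    by move=> j ij; rewrite mulrA -exprD subnKC.
  move: GQ; rewrite (bigID (fun j : 'I_N => (i <= j)%N)) /=.
  rewrite [X in _ + X]big1 ?addr0 // => j; rewrite -ltnNge => /G0->.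
  by rewrite mulr0.
rewrite prime_idealrM => /orP[/prime_idealrX|/QQ'].
  by rewrite (negPf hQ).
rewrite (bigD1 i) //= subnn expr0 mul1r => GiQ.
rewrite -[G i](addrK (\sum_(j < N | (i <= j)%N && (j != i)) h ^+ (j - i) * G j)).
apply: rpredB GiQ _; apply: rpred_sum => j /andP[ij ji].
have : (0 < j - i)%N by rewrite subn_gt0 ltn_neqAle eq_sym ji.
by case: (j - i)%N => // l _; rewrite exprS -mulrA idealrMl.
Qed.

(** A counting form of algebraic independence: the products of powers below [N] of the elements
    chosen in the steps are independent, and their size is linear in [N]. *)
Lemma prime_chain_indep k (c : nat -> prime_idealr R) : prime_chain k c ->
  exists e, forall N, exists (T : finType) (g : T -> R),
    [/\ #|T| = (N ^ k)%N, indep_mod (c 0%N) g &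
        forall t, (msize (g t) <= k * (N * e) + 1)%N].
Proof.
elim: k c => [|k IHk] c ck.
  exists 0%N => N; exists unit, (fun=> 1); split.
  - by rewrite card_unit.
  - move=> a; rewrite (big_pred1 tt) => [aQ []|[]//]; apply/eqP/negPn.
    apply: contraL aQ => a0; apply/negP => /(idealMr (a tt)^-1%:MP).
    rewrite mul_mpolyC scalerA mulVf // scale1r.
    by rewrite idealr1.
  - by move=> _; rewrite msize1.
have [h hQ' hQ] : exists2 h, h \in c 1%N & h \notin c 0%N.
  have [_ nsub] := ck 0%N isT; apply: contrapT => H; apply: nsub => h h1.
  by apply/negPn/negP => h0; apply: H; exists h.
have [|e IH] := IHk (fun i => c i.+1); first by move=> i ik; apply: ck.
(* The factor [h ^+ i], with [i < N], is paid for by [N * (msize h + 3)], which the extra multiple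
   of [N] times the new constant covers. *)
exists (maxn e (msize h + 3)) => N; have [T [g [cT gind gsz]]] := IH N.
exists ('I_N * T)%type, (fun x : 'I_N * T => h ^+ x.1 * g x.2); split.
- by rewrite card_prod card_ord cT expnS.
- by apply: indep_mod_powers hQ' hQ gind; apply: (ck 0%N isT).1.
move=> [i t] /=.
have hX j : (msize (h ^+ j) <= j * (msize h + 1) + 1)%N.
  elim: j => [|j IHj]; first by rewrite expr0 msize1.
  by rewrite exprS; apply: leq_trans (msizeM_le _ _) _; rewrite mulSn; lia.
have := msizeM_le (h ^+ i) (g t); have := hX i; have := gsz t.
have : (i.+1 * (msize h + 3) <= N * maxn e (msize h + 3))%N.
  by apply: leq_mul; [apply: ltn_ord|rewrite leq_maxr].
have : (k * (N * e) <= k * (N * maxn e (msize h + 3)))%N.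
  by rewrite !leq_mul // leq_maxl.
rewrite !mulSn !mulnDr muln1.
move: (N * maxn _ _)%N (k * (N * e))%N => X Y.
move: (k * X)%N (i * msize h)%N (nat_of_ord i) => Z W j.
move: (msize _) (msize _) (msize _) (msize _) => a b c' d.
lia.
Qed.

(** There are [N ^ k] independent polynomials of size at most [N * b], hence [N ^ k <= (N * b) ^ n]
    for every positive [N]. For [k > n] this fails at [N = b ^ n + 1]. *)
Lemma prime_chain_bound k (c : nat -> prime_idealr R) :
  prime_chain k c -> (k <= n)%N.
Proof.
move=> /prime_chain_indep[e H]; rewrite leqNgt; apply/negP => nk.
pose b := (k * e + 1)%N; have [T [g [cT gind gsz]]] := H (b ^ n).+1.
have := indep_card gind gsz; rewrite cT leqNgt => /negP; apply.
set N := (b ^ n).+1.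
apply: (@leq_ltn_trans ((N * b) ^ n)%N).
  have le : (k * (N * e) + 1 <= N * b)%N.
    by rewrite /b mulnCA mulnDr muln1 leq_add2l.
  by case: (posnP n) => [->|n0]; rewrite ?expn0 ?leq_exp2r.
rewrite expnMn; apply: (@leq_trans (N ^ n * N)%N).
  by rewrite ltn_pmul2l ?expn_gt0.
by rewrite -expnSr leq_pexp2l.
Qed.

End PrimeChainBound.

(** * Dickson's lemma *)

Section Dickson.
Local Open Scope nat_scope.

(** Pick a position of least value, then repeatedly one of least value among the later positions. *)
Lemma monotone_subsequence (g : nat -> nat) :
  exists phi : nat -> nat,
    {homo phi : i j / i < j} /\ {homo (g \o phi) : i j / i <= j}.
Proof.
have ex_min m : exists p, m <= p /\ forall q, m <= q -> g p <= g q.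
  have ex : exists v, `[< exists2 p, m <= p & g p = v >].
    by exists (g m); apply/asboolP; exists m.
  have [_ /asboolP[p mp <-] gmin] := ex_minnP ex.
  by exists p; split=> // q mq; apply: gmin; apply/asboolP; exists q.
have [mu muP] := choice ex_min.
pose phi := fix phi k := if k is k'.+1 then mu (phi k').+1 else mu 0.
exists phi; split.
  by apply: homo_ltn => [? ? ? /ltn_trans|k]; [apply|apply: (muP _).1].
apply: homo_leq => [//|? ? ? /leq_trans|[|k]]; [by apply|exact: (muP _).2|].
apply: (muP _).2; apply: leq_trans (muP _).1 _.
exact: leq_trans (leqnSn _) (muP _).1.
Qed.

Variable n : nat.

(** Passing to a subsequence keeps the coordinates already treated monotone, so they can be treated
    in turn. *)
Lemma monotone_subsequence_mnm (s : nat -> 'X_{1..n}) (r : seq 'I_n) :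
  exists phi : nat -> nat, {homo phi : i j / i < j} /\
    forall x, x \in r -> {homo (fun k => s (phi k) x) : i j / i <= j}.
Proof.
elim: r => [|x r [phi [phi_lt phi_le]]].
  by exists id; split=> [i j|x]; rewrite ?in_nil.
have [psi [psi_lt psi_le]] := monotone_subsequence (fun k => s (phi k) x).
exists (phi \o psi); split=> [i j ij|y]; first exact/phi_lt/psi_lt.
rewrite inE => /predU1P[->|yr] i j ij; first exact: psi_le.
by apply: (phi_le y yr); apply: ltnW_homo ij.
Qed.

Lemma dickson_pair (s : nat -> 'X_{1..n}) :
  exists i j, i < j /\ (s i <= s j)%MM.
Proof.
have [phi [phi_lt phi_le]] := monotone_subsequence_mnm s (enum 'I_n).
exists (phi 0), (phi 1); split; first exact: phi_lt.
by apply/mnm_lepP => x; apply: (phi_le x _ 0 1); rewrite ?mem_enum.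
Qed.

End Dickson.

(** * Hilbert's basis theorem *)

Section HilbertBasis.
Variables (K : fieldType) (n : nat).
Local Notation R := {mpoly K[n]}.

Lemma exists_min_mlead (S : R -> Prop) : (exists f, S f) ->
  exists2 f, S f & forall g, S g -> ~ (mlead g < mlead f)%O.
Proof.
case=> f Sf; move: {2}(mlead f) (erefl (mlead f)) Sf => m.
elim/(well_founded_ind (@ltom_wf n)): m f => m IHm f fm Sf.
have [[g [Sg gf]]|nex] := pselect (exists g, S g /\ (mlead g < mlead f)%O).
  by apply: (IHm (mlead g) _ g) => //; rewrite -fm.
by exists f => // g Sg gf; apply: nex; exists g.
Qed.

(* Otherwise pick successively elements of least leading monomial outside the
   ideal generated by the previous ones: by Dickson's lemma one of these leading
   monomials divides a later one, which can then be lowered. *)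
Lemma noetherian_mpoly : noetherian R.
Proof.
move=> J; apply: contrapT => nfg.
(* The inclusion is a premise under the existential so that [choice] gives a total [F]; the value 0
   is a default. *)
have step (s : seq R) : exists f, {subset s <= J} ->
    [/\ f \in J, f \notin ideal_gen s &
        forall g, g \in J -> g \notin ideal_gen s -> ~ (mlead g < mlead f)%O].
  have [sJ|] := pselect {subset s <= J}; last by exists 0.
  have [|f [fJ fs] fmin] := @exists_min_mlead (fun f => f \in J /\ f \notin ideal_gen s).
    apply: contrapT => nex; apply: nfg; exists s => f; apply/idP/idP => [fJ|].
      by apply/negPn/negP => fs; apply: nex; exists f.
    apply: ideal_gen_sub sJ _; first exact: idealr0.
    by case: (idealr_linear J).
  by exists f => _; split=> // g gJ gs; apply: fmin.
have [F FP] := choice step.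
pose S := fix S k := if k is k'.+1 then F (S k') :: S k' else [::].
have SJ k : {subset S k <= J}.
  elim: k => //= k IHk f; rewrite inE => /predU1P[->|/IHk//].
  by have [] := FP _ IHk.
have FS i j : (i < j)%N -> F (S i) \in S j.
  elim: j => //= j IHj; rewrite ltnS inE leq_eqVlt => /predU1P[->|/IHj->].
    by rewrite eqxx.
  by rewrite orbT.
have [i [j [ij lij]]] := dickson_pair (fun k => mlead (F (S k))).
have [fJ fN fmin] := FP _ (SJ j); have [hJ hN _] := FP _ (SJ i).
set f := F (S j) in fJ fN fmin lij; set h := F (S i) in hJ hN lij.
have h0 : h != 0 by apply: contraNneq hN => ->; apply: ideal_gen0.
have f0 : f != 0 by apply: contraNneq fN => ->; apply: ideal_gen0.
(* The multiple [u] of [h] has the leading term of [f], so [f - u] stays outside the ideal with a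
   smaller leading monomial. *)
pose m := (mlead f - mlead h)%MM; pose c := mleadc f / mleadc h.
have mE : (m + mlead h = mlead f)%MM by rewrite submK.
pose u : R := c *: 'X_[m] * h.
have fu : f - u \notin ideal_gen (S j).
  apply: contra fN => fuS; rewrite -[f](subrK u) -[f - u]mul1r.
  apply: ideal_gen_linear => //; rewrite -[u]addr0 ideal_gen_linear ?ideal_gen0 //.
  exact/mem_ideal_gen/FS.
have c0 : c != 0 by rewrite mulf_neq0 ?invr_eq0 ?mleadc_eq0.
apply: (fmin (f - u)) => //; first by rewrite rpredB ?idealMr.
have lu : mlead u = mlead f.
  by rewrite /u -scalerAl mleadZ // mleadM ?mleadXm // -msize_poly_eq0 msizeX.
have g0 : f - u != 0 by apply: contraNneq fu => ->; apply: ideal_gen0.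
have gle : (mlead (f - u) <= mlead f)%O.
  by apply: le_trans (mleadB_le _ _) _; rewrite lu joinxx.
rewrite lt_neqAle gle andbT; apply: contraTneq (mlead_supp g0) => ->.
have uf : u@_(mlead f) = mleadc f.
  rewrite -[in LHS]mE /u -scalerAl mcoeffZ ['X_[m] * h]mulrC mcoeffMX.
  by rewrite divfK ?mleadc_eq0.
by rewrite mcoeff_msupp negbK mcoeffB uf subrr.
Qed.

End HilbertBasis.

(** * Primes generated by variables *)

Section VariablePrimes.
Variables (K : fieldType) (n : nat).
Local Notation R := {mpoly K[n]}.
Implicit Types (S : {set 'I_n}) (f g : R) (m : 'X_{1..n}).

Definition kill_vars S : R -> R :=
  comp_mpoly [tuple if i \in S then 0 else 'X_i | i < n].

Definition mnm_avoids S m := [forall i in S, m i == 0%N].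

Lemma kill_varsX S m : kill_vars S 'X_[m] = if mnm_avoids S m then 'X_[m] else 0.
Proof.
rewrite /kill_vars comp_mpolyX; case: ifPn => [/forall_inP mS|].
  rewrite [RHS]mpolyXE_id; apply: eq_bigr => i _; rewrite tnth_mktuple.
  by case: ifP => // /mS/eqP->.
case/forall_inPn => i iS mi; rewrite (bigD1 i) //= tnth_mktuple iS.
by rewrite expr0n (negPf mi) mul0r.
Qed.

Lemma mcoeff_kill_vars S f m :
  (kill_vars S f)@_m = if mnm_avoids S m then f@_m else 0.
Proof.
rewrite {1}/kill_vars comp_mpolyEX raddf_sum /=.
under eq_bigr => m' _ do rewrite mcoeffZ -/(kill_vars S _) kill_varsX.
have [fm|fm] := boolP (m \in msupp f); last first.
  rewrite (memN_msupp_eq0 fm) if_same big_seq big1 // => m' fm'.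
  case: ifP => _; rewrite ?mcoeff0 ?mulr0 // mcoeffX.
  by case: eqVneq => [e|]; rewrite ?mulr0 // -e fm' in fm *.
rewrite (bigD1_seq m) ?msupp_uniq //= big1 ?addr0.
  by case: ifP; rewrite ?mcoeff0 ?mulr0 // mcoeffX eqxx mulr1.
move=> m' /negPf mm'; case: ifP => _; rewrite ?mcoeff0 ?mulr0 // mcoeffX mm'.
by rewrite mulr0.
Qed.

(** The ideal generated by the variables in [S], encoded as the kernel of a substitution into a
    domain, which makes primality immediate. *)
Definition in_var_prime S f : bool := kill_vars S f == 0.

Lemma kill_varsD S : {morph kill_vars S : f g / f + g}.
Proof. exact: comp_mpolyD. Qed.

Lemma kill_varsM S : {morph kill_vars S : f g / f * g}.
Proof. by move=> f g; rewrite /kill_vars rmorphM. Qed.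

Lemma in_var_primeE S f : (f \in in_var_prime S) = (kill_vars S f == 0).
Proof. by []. Qed.

Lemma var_prime_ideal S : idealr_closed (in_var_prime S).
Proof.
split=> [||a f g]; rewrite !in_var_primeE.
- by rewrite /kill_vars comp_mpoly0.
- by rewrite /kill_vars comp_mpoly1 oner_eq0.
by rewrite kill_varsD kill_varsM => /eqP-> /eqP->; rewrite mulr0 addr0.
Qed.

Lemma var_prime_prime S : prime_idealr_closed (in_var_prime S).
Proof. by move=> f g; rewrite !in_var_primeE kill_varsM mulf_eq0. Qed.

Definition var_prime S : prime_idealr R :=
  mk_prime (var_prime_ideal S) (@var_prime_prime S).

Lemma notin_var_prime S f :
  reflect (exists2 m, m \in msupp f & mnm_avoids S m) (f \notin var_prime S).
Proof.
apply: (iffP idP) => [|[m fm mS]]; last first.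
  apply/negP => /eqP/(congr1 (mcoeff m)); rewrite mcoeff_kill_vars mS mcoeff0.
  by apply/eqP; rewrite -mcoeff_msupp.
rewrite -[_ \in _]/(kill_vars S f == 0) => f0.
have := mlead_supp f0; set m := mlead _; rewrite mcoeff_msupp mcoeff_kill_vars.
by case: ifP => mS; rewrite ?eqxx // -mcoeff_msupp => fm; exists m.
Qed.

Lemma mem_var_primeX S m : ('X_[m] \in var_prime S) = ~~ mnm_avoids S m.
Proof.
apply/idP/idP.
  by apply: contraL => mS; apply/notin_var_prime; exists m; rewrite ?msuppX ?inE.
apply: contraR => /notin_var_prime[m']; by rewrite msuppX inE => /eqP->.
Qed.

Lemma mem_var_primeU S i : ('X_i \in var_prime S) = (i \in S).
Proof.
rewrite mem_var_primeX; apply/forall_inPn/idP => [[j jS]|iS].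
  by rewrite mnm1E eqb0 negbK => /eqP->.
by exists i => //; rewrite mnm1E eqxx.
Qed.

Lemma var_primeS S S' : S \subset S' -> {subset var_prime S <= var_prime S'}.
Proof.
move=> SS' f; apply: contraLR => /notin_var_prime[m fm /forall_inP mS'].
apply/notin_var_prime; exists m => //; apply/forall_inP => i iS.
exact/mS'/(subsetP SS').
Qed.

Lemma var_prime_sub S (J : idealr R) :
  (forall i, i \in S -> 'X_i \in J) -> {subset var_prime S <= J}.
Proof.
move=> SJ f; apply: contraLR; rewrite {1}[f]mpolyE => fJ.
have [m fm] : exists2 m, m \in msupp f & f@_m *: 'X_[m] \notin J.
  apply: contrapT => H; case/negP: fJ; rewrite big_seq; apply: rpred_sum => m fm.
  by apply/negPn/negP => h; apply: H; exists m.
rewrite -mul_mpolyC => mJ; apply/notin_var_prime; exists m => //.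
apply/forall_inP => i iS; apply: contraR mJ => mi; apply: idealMr.
rewrite -(@submK _ U_(i) m) ?lep1mP // mpolyXD idealMr //.
exact: SJ.
Qed.

(** An element of [J] outside the ideal has a nonzero constant term, which would then lie in the
    proper ideal [J]. *)
Lemma var_prime_setT_maximal : maximal_ideal (var_prime setT).
Proof.
move=> J PJ f fJ; apply/negPn/negP => /notin_var_prime[m fm /forall_inP m0].
have {m0}e : m = 0%MM by apply/mnmP => i; rewrite mnm0E; apply/eqP/m0.
have cJ : (f@_m)%:MP \in J.
  rewrite -[_%:MP](subKr f); apply: rpredB => //; apply: PJ.
  apply/negPn/negP => /notin_var_prime[m']; rewrite mcoeff_msupp mcoeffB mcoeffC.
  move=> + /forall_inP m0; have -> : m' = 0%MM.
    by apply/mnmP => i; rewrite mnm0E; apply/eqP/m0.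
  by rewrite e eqxx mulr1 subrr eqxx.
have := idealMr (f@_m)^-1%:MP cJ.
by rewrite -mpolyCM mulVf ?idealr1 // -mcoeff_msupp.
Qed.

(** The missing variables are added one at a time. *)
Lemma var_prime_chain S S' : S \subset S' ->
  exists c, [/\ prime_chain #|S' :\: S| c, c 0%N = var_prime S &
                c #|S' :\: S| = var_prime S'].
Proof.
move=> SS'; pose e := enum (S' :\: S).
pose V k := S :|: [set i in take k e].
exists (fun k => var_prime (V k)); split; last first.
- rewrite /V cardE take_size; congr var_prime.
  apply/setP => i; rewrite !inE mem_enum !inE.
  by case: (boolP (i \in S)) => //= /(subsetP SS').
- by rewrite /V take0; congr var_prime; apply/setP => i; rewrite !inE orbF.
move=> k; rewrite cardE -/e => ke; have x0 : 'I_n by case: (e) ke => [|x].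
pose y := nth x0 e k; have take_y := take_nth x0 ke.
have /andP[yNk _] : (y \notin take k e) && uniq (take k e).
  by rewrite -rcons_uniq -take_y take_uniq ?enum_uniq.
have yS : y \notin S by have := mem_nth x0 ke; rewrite mem_enum inE => /andP[].
split=> [|sub].
  apply: var_primeS; apply: setUS; apply/subsetP => i; rewrite !inE take_y.
  by rewrite mem_rcons inE => ->; rewrite orbT.
have /sub : 'X_y \in var_prime (V k.+1).
  by rewrite mem_var_primeU !inE take_y mem_rcons inE eqxx orbT.
by rewrite mem_var_primeU !inE (negPf yS) (negPf yNk).
Qed.

(** A chain ending here extends by [n - #|S|] steps up to the ideal of all variables, so the bound
    [n] on the total length leaves at most [#|S|]. *)
Lemma has_height_var_prime S : has_height (var_prime S) #|S|.
Proof.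
split.
  have [c [cc _ ce]] := var_prime_chain (sub0set S).
  by rewrite setD0 in cc ce; exists c; rewrite // ce.
move=> k c cc ce; have [c' [cc' c0 _]] := var_prime_chain (subsetT S).
have [f|c2 /prime_chain_bound ub _] := prime_chain_cat cc cc'.
  by rewrite c0 ce.
by move: ub; have := cardsC S; rewrite setTD card_ord; lia.
Qed.

(* A chain of primes above [P_S] extends a maximal chain below [P_S]. *)
Lemma prime_chain_above S k c :
  prime_chain k c -> {subset var_prime S <= c 0%N} -> (k + #|S| <= n)%N.
Proof.
move=> ck Sc; have [c' [cc' _ c1]] := var_prime_chain (sub0set S).
rewrite setD0 in cc' c1.
have [|c2 /prime_chain_bound ub _] := prime_chain_cat cc' ck; first by rewrite c1.
by rewrite addnC.
Qed.

End VariablePrimes.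

(** * Monomial ideals *)

Section MonomialIdeals.
Variables (K : fieldType) (n : nat).
Local Notation R := {mpoly K[n]}.
Implicit Types (f g : R) (m : 'X_{1..n}).

Section UpwardClosed.
Variable up : pred 'X_{1..n}.
Hypothesis upD : forall m m', up m -> up (m' + m)%MM.

(** With [up] closed under multiplication, this is membership in the monomial ideal it spans. *)
Definition monomials_in f := all up (msupp f).

Lemma monomials_in0 : monomials_in 0.
Proof. by rewrite /monomials_in msupp0. Qed.

Lemma monomials_in_linear a f g :
  monomials_in f -> monomials_in g -> monomials_in (a * f + g).
Proof.
move=> /allP uf /allP ug; apply/allP => m /msuppD_le; rewrite mem_cat.
case/orP=> [/msuppM_le/allpairsP[[m1 m2] /= [_ m2f ->]]|/ug//].
exact/upD/uf.
Qed.

Lemma monomials_inMX f m :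
  monomials_in (f * 'X_[m]) = all (fun m' => up (m' + m)%MM) (msupp f).
Proof.
rewrite /monomials_in (perm_all _ (msuppMX f m)) all_map.
by apply: eq_all => m' /=; rewrite addmC.
Qed.

End UpwardClosed.

Lemma exists_argmin (T : Type) (P : T -> Prop) (mu : T -> nat) :
  (exists x, P x) -> exists2 x, P x & forall y, P y -> (mu x <= mu y)%N.
Proof.
case=> x Px.
have ex : exists v, `[< exists2 x, P x & mu x = v >].
  by exists (mu x); apply/asboolP; exists x.
have [_ /asboolP[y Py <-] ymin] := ex_minnP ex.
by exists y => // z Pz; apply: ymin; apply/asboolP; exists z.
Qed.

(* If [up] does not depend on the exponent of [x_j], the ideal it spans is
   primary to [P_(~j)].  The coefficient witnessing this is that of the product
   of the lowest monomials, ordered by degree in the variables other than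
   [x_j] and then by the exponent of [x_j]. *)
Lemma monomials_in_primary (up : pred 'X_{1..n}) (j : 'I_n) t f :
    (forall m m', up m -> up (m' + m)%MM) ->
    (forall m m', mnm_avoids [set~ j] m' -> up (m' + m)%MM = up m) ->
    t \notin var_prime K [set~ j] ->
  monomials_in up (t * f) -> monomials_in up f.
Proof.
move=> upD upj /notin_var_prime tj; apply: contraTT => /allPn[m0 m0f m0up].
(* [d] is the degree in the variables other than [x_j]. As [b] exceeds all exponents in [f], the
   measure [d m * b + m j] below is lexicographic on the monomials of [f]. *)
pose d m := (mdeg m - m j)%N; pose b := msize f.
have mj_le m : (m j <= mdeg m)%N by rewrite mdegE (bigD1 j) //= leq_addr.
have dE m : (mdeg m = d m + m j)%N by rewrite subnK.
have dD m m' : (d (m + m')%MM = d m + d m')%N.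
  by have := dE (m + m')%MM; rewrite mdegD (dE m) (dE m') mnmDE; lia.
have d0 m : mnm_avoids [set~ j] m -> d m = 0%N.
  move=> /forall_inP av; rewrite /d mdegE (bigD1 j isT) /= big1 ?addn0 ?subnn //.
  by move=> i ij; apply/eqP/av; rewrite !inE.
have d0_inj m m' : d m = 0%N -> d m' = 0%N -> m j = m' j -> m = m'.
  move=> dm dm' e; apply/mnmP => i; have [->//|ij] := eqVneq i j.
  have zero m1 : d m1 = 0%N -> m1 i = 0%N.
    by have := dE m1; rewrite mdegE (bigD1 j isT) /= (bigD1 i ij) /=; lia.
  by rewrite !zero.
have [mt [mtt mtj] mtmin] := @exists_argmin _
  (fun m => m \in msupp t /\ mnm_avoids [set~ j] m) (fun m => m j)
  (let: ex_intro2 m a b := tj in ex_intro _ m (conj a b)).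
have [mf [mff mfup] mfmin] := @exists_argmin _
  (fun m => m \in msupp f /\ ~~ up m) (fun m => d m * b + m j)%N
  (ex_intro _ m0 (conj m0f m0up)).
(* No other pair of monomials has this product: its second member would also fail [up], and the two
   minimal choices then force equality. *)
have coef : (t * f)@_(mt + mf) = t@_mt * f@_mf.
  rewrite mpolyME raddf_sum /= (bigD1_seq (mt, mf)) /=; last 2 first.
  - by rewrite allpairs_f.
  - by rewrite allpairs_uniq ?msupp_uniq // => -[? ?] [].
  rewrite mcoeffZ mcoeffX eqxx mulr1 big_seq_cond big1 ?addr0 //.
  move=> [m1 m2] /andP[/allpairsP[[m1' m2'] /= [m1t m2f [-> ->]]] neq] {m1 m2}.
  rewrite mcoeffZ mcoeffX; case: eqVneq => [e|]; last by rewrite mulr0.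
  case/eqP: neq; have m2up : ~~ up m2'.
    by apply: contra mfup => /(upD _ m1'); rewrite e upj.
  have := mfmin _ (conj m2f m2up).
  have m2b : (m2' j < b)%N := leq_ltn_trans (mj_le _) (msize_mdeg_lt m2f).
  have mfb : (mf j < b)%N := leq_ltn_trans (mj_le _) (msize_mdeg_lt mff).
  have := congr1 d e; rewrite !dD (d0 _ mtj) add0n => ed.
  have ej : (m1' j + m2' j = mt j + mf j)%N by rewrite -!mnmDE e.
  move=> le; have d1 : d m1' = 0%N.
    apply/eqP; rewrite -leqn0 leqNgt; apply/negP => d1.
    move: le; rewrite -ed mulnDl; have : (b <= d m1' * b)%N by rewrite leq_pmull.
    by lia.
  have av : mnm_avoids [set~ j] m1'.
    apply/forall_inP => i; rewrite !inE => ij; move: d1 (dE m1').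
    by rewrite mdegE (bigD1 j isT) /= (bigD1 i ij) /=; clear; lia.
  have := mtmin _ (conj m1t av).
  move: le; rewrite -ed d1 add0n => le le'.
  have e1 : m1' = mt.
    by apply: d0_inj (d0 _ av) (d0 _ mtj) _; move: le le' ej; clear; lia.
  by congr pair => //; move: e; rewrite e1 => /addmI.
apply/allPn; exists (mt + mf)%MM; last by rewrite upj.
by rewrite mcoeff_msupp coef mulf_neq0 // -mcoeff_msupp.
Qed.

End MonomialIdeals.

(** * The edge ideal *)

Section EdgeIdealFacts.
Variables (K : fieldType) (n : nat) (D : wograph 'I_n).
Hypothesis V_full : vertices D = [set: 'I_n].
Hypothesis complete : complete_underlying D.
Local Notation R := {mpoly K[n]}.
Local Notation I := (edge_ideal K D).
Local Notation w := (weight D).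
Implicit Types (f g : R) (m : 'X_{1..n}) (i j k : 'I_n).

Let w_gt0 i : (0 < w i)%N.
Proof. by apply: weight_gt0; rewrite V_full inE. Qed.

Let dedge_total i j : i != j -> dedge D i j || dedge D j i.
Proof. by move=> ij; apply: complete => //; rewrite V_full inE. Qed.

(** Divisibility by a generator; the ends of an edge are distinct, so the two exponents are tested
    separately. *)
Definition edge_mnm m :=
  [exists x, [exists y, [&& dedge D x y, m x != 0%N & (w y <= m y)%N]]].

Lemma edge_mnmP m :
  reflect (exists x y, [/\ dedge D x y, m x != 0%N & (w y <= m y)%N]) (edge_mnm m).
Proof.
apply: (iffP existsP) => [[x /existsP[y /and3P[]]]|[x [y [xy mx my]]]].
  by exists x, y.
by exists x; apply/existsP; exists y; rewrite xy mx.
Qed.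

Lemma edge_mnmD m m' : edge_mnm m -> edge_mnm (m' + m)%MM.
Proof.
move=> /edge_mnmP[x [y [xy mx my]]]; apply/edge_mnmP; exists x, y; split=> //.
  by rewrite mnmDE addn_eq0 negb_and mx orbT.
by rewrite mnmDE (leq_trans my) // leq_addl.
Qed.

Lemma edge_generatorE (e : 'I_n * 'I_n) :
  'X_e.1 * 'X_e.2 ^+ w e.2 = 'X_[U_(e.1) + U_(e.2) *+ w e.2] :> R.
Proof. by rewrite mpolyXD mpolyXn. Qed.

Lemma mem_edge_ideal f : (f \in I) = monomials_in edge_mnm f.
Proof.
apply/idP/idP.
  apply: (@ideal_gen_sub _ _ (monomials_in edge_mnm)).
  - exact: monomials_in0.
  - by move=> a u v; apply: monomials_in_linear; apply: edge_mnmD.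
  move=> _ /mapP[e + ->]; rewrite mem_enum => eD.
  rewrite edge_generatorE /monomials_in [_ \in _]/(all _ _) msuppX /= andbT.
  apply/edge_mnmP; exists e.1, e.2; rewrite /dedge /= -surjective_pairing.
  rewrite !mnmDE !mulmnE !mnm1E !eqxx mul1n; split=> //.
  by rewrite leq_addl.
move=> /allP fI; rewrite [f]mpolyE big_seq; apply: rpred_sum => m /fI.
move=> /edge_mnmP[x [y [xy mx my]]]; rewrite -mul_mpolyC; apply: idealMr.
have le : (U_(x) + U_(y) *+ w y <= m)%MM.
  apply/mnm_lepP => i; rewrite mnmDE mulmnE !mnm1E.
  have [xi|xi] := eqVneq x i; have [yi|yi] := eqVneq y i; rewrite ?mul1n ?mul0n //.
  - by rewrite xi yi dedgexx in xy.
  - by rewrite addn0 -xi lt0n.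
  - by rewrite add0n -yi.
rewrite -(submK le) mpolyXD; apply: idealMr.
rewrite -[x]/((x, y).1) -[y]/((x, y).2) -edge_generatorE.
by apply/mem_ideal_gen/map_f; rewrite mem_enum.
Qed.

Lemma edge_ideal_sub_var_prime i : {subset I <= var_prime K [set~ i]}.
Proof.
move=> f; rewrite mem_edge_ideal => /allP fI.
apply/negPn/negP => /notin_var_prime[m /fI/edge_mnmP[x [y [xy mx my]]]].
move=> /forall_inP av; have [xi|xi] := eqVneq x i; last first.
  by case/negP: mx; apply: av; rewrite !inE.
have yi : y != i by apply: contraTneq xy => ->; rewrite xi dedgexx.
have /eqP my0 : m y == 0%N by apply: av; rewrite !inE.
by move: my; rewrite my0 leqNgt w_gt0.
Qed.

Lemma edge_ideal_sub_setT : (0 < n)%N -> {subset I <= var_prime K setT}.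
Proof.
move=> n0 f /(edge_ideal_sub_var_prime (Ordinal n0)); apply: var_primeS.
exact: subsetT.
Qed.

(** If [x_i] is not in [P], the generator of the edge between [i] and [j] forces [x_j] into [P], for
    every [j != i]. *)
Lemma prime_over_edge_ideal (P : prime_idealr R) :
  (0 < n)%N -> {subset I <= P} -> exists i, {subset var_prime K [set~ i] <= P}.
Proof.
move=> n0 IP; have [XP|] := pselect (forall i, 'X_i \in P).
  by exists (Ordinal n0); apply: var_prime_sub.
move=> /existsNP[i /negP iP]; exists i; apply: var_prime_sub => j.
rewrite !inE => ji.
have edgeP x y : dedge D x y -> 'X_x * 'X_y ^+ w y \in P.
  move=> xy; apply: IP; apply: mem_ideal_gen; apply/mapP.
  by exists (x, y); rewrite ?mem_enum.
case/orP: (dedge_total ji) => /edgeP; rewrite prime_idealrM.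
  by case/orP=> // /prime_idealrX; rewrite (negPf iP).
by rewrite (negPf iP) => /prime_idealrX.
Qed.

Lemma var_prime_setC_strict i :
  {subset var_prime K [set~ i] <= var_prime K setT} /\
  ~ {subset var_prime K setT <= var_prime K [set~ i]}.
Proof.
split; first exact/var_primeS/subsetT.
have XT : 'X_i \in var_prime K setT by rewrite mem_var_primeU in_setT.
have XN : 'X_i \notin var_prime K [set~ i].
  by rewrite mem_var_primeU in_setC1 eqxx.
by move=> /(_ _ XT); apply/negP.
Qed.

(** * Minimal primary components of the edge ideal *)

Section LocalMonomials.
Variable j : 'I_n.

(** The component at [P_j] comes from putting [x_j = 1] in the generators: it is spanned by [x_k]
    for [k -> j] and [x_k ^ w k] for [j -> k]. *)
Definition local_edge_mnm m :=
  [exists k, (dedge D k j && (m k != 0%N)) || (dedge D j k && (w k <= m k)%N)].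

Lemma local_edge_mnmD m m' : local_edge_mnm m -> local_edge_mnm (m' + m)%MM.
Proof.
move=> /existsP[k h]; apply/existsP; exists k; rewrite mnmDE.
case/orP: h => /andP[-> /= h]; apply/orP; [left|right].
  by rewrite addn_eq0 negb_and h orbT.
by rewrite (leq_trans h) // leq_addl.
Qed.

Lemma local_edge_mnm_indep m m' :
  mnm_avoids [set~ j] m' -> local_edge_mnm (m' + m)%MM = local_edge_mnm m.
Proof.
move=> /forall_inP av; apply: eq_existsb => k; rewrite mnmDE.
have [->|kj] := eqVneq k j; first by rewrite dedgexx.
by rewrite (eqP (av k _)) ?add0n // !inE.
Qed.

(** The generator of an edge avoiding [j] is a multiple of one coming from an edge at [j]. *)
Lemma edge_local_mnm m : edge_mnm m -> local_edge_mnm m.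
Proof.
move=> /edge_mnmP[x [y [xy mx my]]]; apply/existsP.
have my0 : m y != 0%N by rewrite -lt0n (leq_trans (w_gt0 y)).
have [xj|xj] := eqVneq x j; first by exists y; rewrite -xj xy my orbT.
case/orP: (dedge_total xj) => h; first by exists x; rewrite h mx.
have [yj|yj] := eqVneq y j; first by rewrite -yj (dedge_antisym xy) in h.
case/orP: (dedge_total yj) => h'; first by exists y; rewrite h' my0.
by exists y; rewrite h' my orbT.
Qed.

End LocalMonomials.

(** If [m] avoids all generators, then [m y < w y] for all [y], since otherwise the condition at [y]
    yields an edge. At an undominated [v] the condition then gives [k -> v] with [m k != 0] and
    [w k = 1], a contradiction. *)
Lemma local_all_edge_mnm m : ~~ all_dominated D ->
  (forall j, local_edge_mnm j m) -> edge_mnm m.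
Proof.
move=> /forallPn[v /existsPn vN] loc_m; apply: contrapT => mN.
have light y : (m y < w y)%N.
  rewrite ltnNge; apply/negP => my; apply: mN.
  have my0 : m y != 0%N by rewrite -lt0n (leq_trans (w_gt0 y)).
  have /existsP[k /orP[] /andP[h h']] := loc_m y; apply/edge_mnmP.
    by exists k, y.
  by exists y, k.
have /existsP[k /orP[] /andP[h h']] := loc_m v; last first.
  by rewrite leqNgt light in h'.
have := vN k; rewrite h negbK /= => /eqP wk.
by have := light k; rewrite wk ltnS leqn0 (negPf h').
Qed.

(* If some vertex is not dominated, then [I] is the intersection of its minimal
   primary components. *)
Lemma colon_sub_var_prime f : ~~ all_dominated D -> f \notin I ->
  exists i, forall t, t * f \in I -> t \in var_prime K [set~ i].
Proof.
move=> good; rewrite mem_edge_ideal => /allPn[m mf mN].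
have [j jN] : exists j, ~~ local_edge_mnm j m.
  apply: contrapT => H; case/negP: mN; apply: local_all_edge_mnm => // j.
  by have [//|jN] := boolP (local_edge_mnm j m); case: H; exists j.
exists j => t; rewrite mem_edge_ideal => tf; apply/negPn/negP => tN.
have loc_tf : monomials_in (local_edge_mnm j) (t * f).
  by apply: sub_all tf => m2; apply: edge_local_mnm.
have := monomials_in_primary (@local_edge_mnmD j) (@local_edge_mnm_indep j) tN loc_tf.
by move=> /allP/(_ m mf); rewrite (negPf jN).
Qed.

Lemma mul_edge_idealX f m :
  (f * 'X_[m] \in I) = all (fun m' => edge_mnm (m' + m)%MM) (msupp f).
Proof. by rewrite mem_edge_ideal monomials_inMX. Qed.

(** Multiplying the witness by [x_j] raises that exponent to [w j], and a dominating in-neighbour of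
    [j] occurs in it. The witness itself has all exponents below the weights. *)
Lemma associated_var_prime_setT :
  all_dominated D -> associated_prime I (var_prime K setT).
Proof.
move=> /forallP dom; pose u := [multinom (w i).-1 | i < n].
exists 'X_[u] => g; rewrite mul_edge_idealX; apply/idP/idP.
  apply: contraTT => /allPn[m mg mu]; apply/notin_var_prime; exists m => //.
  apply/forall_inP => j _; apply: contraR mu => mj.
  have /existsP[i /andP[ij wi]] := dom j; apply/edge_mnmP; exists i, j.
  rewrite !mnmDE !mnmE; split=> //.
    by have := w_gt0 i; move: wi; lia.
  by move: mj; have := w_gt0 j; lia.
apply: contraTT => /notin_var_prime[m mg /forall_inP m0]; apply/allPn.
exists m => //; apply/negP => /edge_mnmP[x [y [xy _]]].
have /eqP my := m0 y (in_setT y).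
by rewrite mnmDE mnmE my; have := w_gt0 y; lia.
Qed.

(** The witness is [x_i ^ w i] times the [x_j ^ (w j - 1)] for [i -> j]. A factor [x_j] completes
    the edge between [i] and [j]; powers of [x_i] complete none, as no in-neighbour of [i]
    occurs. *)
Lemma associated_var_prime_setC i : associated_prime I (var_prime K [set~ i]).
Proof.
pose v := [multinom if j == i then w i else if dedge D i j then (w j).-1 else 0%N
          | j < n].
exists 'X_[v] => g; rewrite mul_edge_idealX; apply/idP/idP.
  apply: contraTT => /allPn[m mg mv]; apply/notin_var_prime; exists m => //.
  apply/forall_inP => j; rewrite !inE => ji; apply: contraR mv => mj.
  have wi := w_gt0 i; have wj := w_gt0 j; apply/edge_mnmP.
  case/orP: (dedge_total ji) => h; [exists j, i|exists i, j];
    rewrite !mnmDE !mnmE eqxx (negPf ji) ?h; split=> //; lia.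
apply: contraTT => /notin_var_prime[m mg /forall_inP m0]; apply/allPn.
have {}m0 j : j != i -> m j = 0%N by move=> ji; apply/eqP/m0; rewrite !inE.
exists m => //; apply/negP => /edge_mnmP[x [y [xy]]]; rewrite !mnmDE !mnmE.
have [yi|yi] := eqVneq y i.
  have xi : x != i by apply: contraTneq xy => ->; rewrite yi dedgexx.
  by rewrite (negPf xi) m0 // -yi (dedge_antisym xy).
by move=> _; rewrite m0 //; have := w_gt0 y; case: ifP; lia.
Qed.

(** Take [x_i * e] plus the sum of the other variables, with [e] in [M] outside [P_i]. Modulo [P_i]
    only the first term survives; modulo another [P_j], only [x_j]. *)
Lemma exists_avoiding_var_primes i (M : prime_idealr R) :
    {subset var_prime K [set~ i] <= M} -> ~ {subset M <= var_prime K [set~ i]} ->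
  exists2 t, t \in M & forall j, t \notin var_prime K [set~ j].
Proof.
move=> PM MP; have [e eM eP] : exists2 e, e \in M & e \notin var_prime K [set~ i].
  apply: contrapT => H; apply: MP => e eM.
  by apply/negPn/negP => h; apply: H; exists e.
have XP j k : ('X_k \in var_prime K [set~ j]) = (k != j).
  by rewrite mem_var_primeU !inE.
have sumP j (F : pred 'I_n) : ~~ F j ->
    \sum_(k | F k) 'X_k \in var_prime K [set~ j].
  move=> Fj; apply: rpred_sum => k Fk; rewrite XP.
  by apply: contraTneq Fk => ->.
have subP (P : prime_idealr R) a b : b \in P -> a + b \in P -> a \in P.
  by move=> bP abP; rewrite -[a](addrK b) rpredB.
have sum_iP : \sum_(k | k != i) 'X_k \in var_prime K [set~ i].
  by apply: sumP; rewrite negbK.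
exists ('X_i * e + \sum_(k | k != i) 'X_k) => [|j].
  by apply: rpredD; [apply: idealMr|apply: PM].
have [->|ji] := eqVneq j i.
  by apply: contra eP => /(subP _ _ _ sum_iP); rewrite prime_idealrM XP eqxx.
have rest : 'X_i * e + \sum_(k | (k != i) && (k != j)) 'X_k \in var_prime K [set~ j].
  apply: rpredD; first by apply: idealrMl; rewrite XP eq_sym.
  by apply: sumP; rewrite eqxx andbF.
rewrite (bigD1 j ji) addrCA; apply/negP => /(subP _ _ _ rest).
by rewrite XP eqxx.
Qed.

End EdgeIdealFacts.

(** * Heights and associated primes *)

Section Heights.
Variable A : comNzRingType.

Lemma has_height_uniq (P : prime_idealr A) d d' :
  has_height P d -> has_height P d' -> d = d'.
Proof.
case=> [[c cd cP] ub] [[c' cd' cP'] ub']; apply/eqP; rewrite eqn_leq.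
by rewrite (ub' _ _ cd cP) (ub _ _ cd' cP').
Qed.

Lemma has_height_eqi (P Q : prime_idealr A) d :
  P =i Q -> has_height P d -> has_height Q d.
Proof.
move=> PQ [[c cd cP] ub]; split=> [|k c' ck cQ].
  by exists c => // a; rewrite cP PQ.
by apply: (ub _ _ ck) => a; rewrite cQ PQ.
Qed.

Lemma associated_prime_sub (I : idealr A) (P : prime_idealr A) :
  associated_prime I P -> {subset I <= P}.
Proof. by case=> f fP g gI; rewrite fP idealrMl. Qed.

End Heights.

(** * Unmixedness and the Cohen-Macaulay property *)

Section EdgeRing.
Variables (K : fieldType) (n : nat) (D : wograph 'I_n).
Hypothesis V_full : vertices D = [set: 'I_n].
Hypothesis complete : complete_underlying D.
Local Notation R := {mpoly K[n]}.
Local Notation I := (edge_ideal K D).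

Lemma var_prime_setC_inj (i j : 'I_n) :
  {subset var_prime K [set~ j] <= var_prime K [set~ i]} -> j = i.
Proof.
move=> sub; apply/eqP/negPn/negP => ji.
have Xj : 'X_i \in var_prime K [set~ j].
  by rewrite mem_var_primeU in_setC1 eq_sym.
have XN : 'X_i \notin var_prime K [set~ i].
  by rewrite mem_var_primeU in_setC1 eqxx.
by move: (sub _ Xj); apply/negP.
Qed.

(** Under domination, associated primes of heights [n] and [n - 1] coexist. Otherwise an associated
    prime contains some [P_j] and lies in some [P_i], so it equals [P_i]. *)
Lemma unmixed_edge_ideal :
  unmixed I <-> ~~ ((0 < n)%N && all_dominated D).
Proof.
split=> [[h hP]|].
  apply/negP => /andP[n0 dom].
  have h1 := hP _ (associated_var_prime_setT K V_full dom).
  have h2 := hP _ (associated_var_prime_setC K V_full complete (Ordinal n0)).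
  have := has_height_uniq h1 (has_height_var_prime K setT).
  have := has_height_uniq h2 (has_height_var_prime K [set~ Ordinal n0]).
  by rewrite cardsT cardsC1 card_ord; lia.
rewrite negb_and => /orP[|good].
  (* Without variables all chains of primes have length 0, and so all heights are 0. *)
  rewrite lt0n negbK => /eqP n0; exists 0%N => P _.
  have [d dP] := @has_height_exists _ P n (fun k c ck _ => prime_chain_bound ck).
  have [[c /prime_chain_bound + _] _] := dP.
  by rewrite {1}n0 leqn0 => /eqP d0; rewrite -d0.
exists n.-1 => P Pass.
have [f fP] := Pass; have fN : f \notin I by rewrite -[f]mul1r -fP idealr1.
have IP := associated_prime_sub Pass.
have [i Pi] := colon_sub_var_prime V_full complete good fN.
have n0 : (0 < n)%N by apply: leq_trans (ltn_ord i).
have [j jP] := prime_over_edge_ideal V_full complete n0 IP.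
have {}Pi : {subset P <= var_prime K [set~ i]} by move=> g; rewrite fP; apply: Pi.
have ji : j = i by apply: var_prime_setC_inj => g /jP/Pi.
have := has_height_var_prime K [set~ i]; rewrite cardsC1 card_ord.
by apply: has_height_eqi => g; apply/idP/idP => [|/Pi//]; rewrite -ji => /jP.
Qed.

Lemma prime_chain_over_edge_ideal k (c : nat -> prime_idealr R) : (0 < n)%N ->
  prime_chain k c -> {subset I <= c 0%N} -> (k <= 1)%N.
Proof.
move=> n0 ck Ic; have [i iP] := prime_over_edge_ideal V_full complete n0 Ic.
by have := prime_chain_above ck iP; rewrite cardsC1 card_ord; lia.
Qed.

Lemma cm_local_edge_ring (m : prime_idealr (edge_ring K D)) :
  (0 < n)%N -> ~~ all_dominated D -> maximal_ideal m ->
  cohen_macaulay_local (localization m).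
Proof.
move=> n0 good mmax; pose M := contraction (quot_map I) m.
have loc := localization_quotient m.
have IM : {subset I <= M} by case: loc.
have [i iM] := prime_over_edge_ideal V_full complete n0 IM.
have [iT Ti] := var_prime_setC_strict K i.
have Mi : ~ {subset M <= var_prime K [set~ i]}.
  by apply: contraction_maximal mmax (edge_ideal_sub_setT V_full n0) iT Ti.
have [t tM tN] := exists_avoiding_var_primes iM Mi.
apply: (cm_local_dim1 loc (@edge_ideal_sub_var_prime K n D V_full i) iM Mi _ tM).
- by move=> k c ck Ic _; apply: prime_chain_over_edge_ideal ck Ic.
- move=> b tb; apply: contrapT => /negP bN.
  have [j /(_ t tb) tj] := colon_sub_var_prime V_full complete good bN.
  by have := tN j; rewrite tj.
move=> Q IQ QM MQ a aQ; have [j jQ] := prime_over_edge_ideal V_full complete n0 IQ.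
have aj : a \in var_prime K [set~ j].
  apply: contrapT => aj.
  (* Otherwise [P_j], [Q], [M] would form a chain of length 2 over the edge ideal. *)
  pose c k := if k is k'.+1 then if k' is 0 then Q else M else var_prime K [set~ j].
  suff chain2 : prime_chain 2 c.
    have := prime_chain_over_edge_ideal n0 chain2.
    by move=> /(_ (@edge_ideal_sub_var_prime K n D V_full j)).
  case=> [|[|//]] _; split; [exact: jQ| |exact: QM|exact: MQ].
  by move=> Qj; apply: aj; apply: Qj.
have [b bP] := associated_var_prime_setC K V_full complete j.
exists b; first by rewrite -bP.
by move=> u uM; rewrite -bP; apply: contra uM => /jQ/QM.
Qed.

(** Without variables the polynomial ring is the field [K]: the maximal ideal of the localization is
    zero, and depth and dimension are 0. *)
Lemma cm_local_edge_ring0 (m : prime_idealr (edge_ring K D)) :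
  n = 0%N -> cohen_macaulay_local (localization m).
Proof.
move=> n0; pose M := contraction (quot_map I) m.
have loc := localization_quotient m; have [_ fracL _ _] := loc.
exists (local_max loc); split; first exact: local_max_maximal.
  exact: local_max_unique.
exists 0%N; last first.
  split; first by exists (fun=> local_max loc).
  move=> k c /(contraction_chain loc)/prime_chain_bound; by rewrite n0.
split.
  exists [::]; split=> //; split; last by [].
  by rewrite mem_ideal_gen_nil oner_eq0.
case=> // s0 s reg sm; exfalso.
have [a [r [rM e]]] := fracL s0.
have aM : a \in M.
  by rewrite -(mem_local_max loc) -e idealrMl // sm // inE eqxx.
have a0 : a = 0.
  apply: contrapT => /eqP aN; have := idealMr (a@_0)^-1%:MP aM.
  move: aN; rewrite [a](nvar0_mpolyC_eq a n0) mpolyC_eq0 => aN.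
  by rewrite mcoeffC eqxx mulr1 -mpolyCM mulVf // idealr1.
have s00 : s0 = 0 by apply: (cancel_unitL loc rM); rewrite e a0 rmorph0 mul0r.
move: reg; rewrite s00 => /regular_sequence_head/(_ (mul0r 1))/eqP.
by rewrite oner_eq0.
Qed.

(** Under domination with [0 < n], the localization at the origin already fails, its maximal ideal
    being the annihilator of a nonzero element. *)
Lemma cohen_macaulay_edge_ring :
  cohen_macaulay (edge_ring K D) <-> ~~ ((0 < n)%N && all_dominated D).
Proof.
split=> [[_ cm]|good]; last first.
  split; first exact/noetherian_quotient/noetherian_mpoly.
  move=> m mmax; have [n0|] := posnP n; first exact: cm_local_edge_ring0.
  by move: good; case: posnP => //= n0 good _; apply: cm_local_edge_ring.
apply/negP => /andP[n0 dom].
have IT := @edge_ideal_sub_setT K _ _ V_full n0.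
have mmax := @quot_prime_maximal _ _ _ IT (@var_prime_setT_maximal K n).
have loc := localization_quotient (quot_prime IT).
have [u uP] := associated_var_prime_setT K V_full dom.
pose i := Ordinal n0; have [iT Ti] := var_prime_setC_strict K i.
have ME g : (g \in contraction (quot_map I) (quot_prime IT)) = (g \in var_prime K setT).
  exact: mem_quot_prime.
apply: (not_cm_local loc (@edge_ideal_sub_var_prime K n D V_full i) (w := u)) (cm _ mmax).
- by move=> g; rewrite ME; apply: iT.
- by move=> h; apply: Ti => g; rewrite -ME; apply: h.
- by move=> g; rewrite ME uP.
- by move=> g; rewrite ME uP.
Qed.

End EdgeRing.

Theorem theorem5p7 (K : fieldType) (n : nat) (D : wograph 'I_n)
    (V_full : vertices D = [set: 'I_n])
    (sources1 : sources_have_weight1 D)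
    (complete : complete_underlying D) :
  (unmixed (edge_ideal K D) <-> cohen_macaulay (edge_ring K D)) /\
  (cohen_macaulay (edge_ring K D) <-> ~ unicycle_partition D).
Proof.
have unm := unmixed_edge_ideal K V_full complete.
have cm := cohen_macaulay_edge_ring K V_full complete.
have part := unicycle_partitionP V_full; rewrite card_ord in part.
split; first exact: iff_trans unm (iff_sym cm).
apply: iff_trans cm _; split=> [/negP|] h; first by move=> /part.
by apply/negP => /part.
Qed.
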